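(* Let $G(V,E)$ be a weighted directed graph with $n$ vertices and $m$ edges, let $U\subseteq V$ be an arbitrary set of vertices, let $S\subseteq V$ be a fixed (but unknown to the algorithm) set of vertices of size $s\ge 2$, and let $r>0$. Run the procedure Cluster-Out$(G,U,r,s)$ (or Cluster-In$(G,U,r,s)$) described below, producing a partition $(V_1,\dots,V_d)$ of $V$. Then: (1) for $c\ge 1$, with probability at least $1-n/s^{c}$, all clusters $V_1,\dots,V_{d-1}$ (all except the last cluster $V_d$) have radius at most $c\cdot r$; (2) the last cluster satisfies $|V_d|\le |V|-|U|$; (3) for every $u\in S$, $v\in V$ and $R>0$ with $d(u\rightleftarrows v)\le R$, $u$ and $v$ are in the same cluster $V_i$ with probability at least $\exp(-(R/r)\cdot\log s)$. Furthermore, the procedure runs in time $O(m\log n)$.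
   Context: $d(u,v)$ denotes the one-way shortest-path distance from $u$ to $v$ in $G$ and $d(u\rightleftarrows v)=d(u,v)+d(v,u)$. The exponential distribution $\mathrm{Exp}(\beta)$ has density $\beta e^{-\beta x}$ for $x\ge 0$. Procedure Cluster-Out$(G,U,r,s)$: set $\beta=\log(s)/r$; independently for each $u\in U$ draw $r_u\sim\mathrm{Exp}(\beta)$; each vertex $v\in V$ is assigned to the cluster centered at the vertex $u\in U$ maximizing $r_u-d(u,v)$, provided this maximum is positive, and otherwise $v$ is not assigned. Let $V_1,\dots,V_{d-1}$ be the clusters so formed and $V_d=V\setminus\bigcup_{i\le d-1}V_i$; return $(V_1,\dots,V_d)$. Procedure Cluster-In is identical except that $d(u,v)$ is replaced by $d(v,u)$. The radius of a cluster refers to its distance radius from its center (out-distances for Cluster-Out, in-distances for Cluster-In).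
   Formalization: Edge weights are taken nonnegative; (2) is stated almost surely (all draws positive); the time bound O(m log n) is stated for n ≤ m+1 (it fails for m = 0), with O((n+m) log n) for every graph. *)

(* Defs.v *)
From HB Require Import structures.
From mathcomp Require Import all_boot all_order all_algebra.
From mathcomp Require Import all_classical all_reals all_analysis.

Set Implicit Arguments.
Unset Strict Implicit.
Unset Printing Implicit Defensive.
Import Order.TTheory GRing.Theory Num.Theory.
Import numFieldNormedType.Exports.
Local Open Scope classical_set_scope.
Local Open Scope ring_scope.

Record wdigraph (R : realType) (n : nat) := WDigraph {
  edges : {set 'I_n * 'I_n};
  weight : 'I_n -> 'I_n -> R;
  weight_ge0 : forall u v, (u, v) \in edges -> 0 <= weight u v }.

Section Distance.
Variables (R : realType) (n : nat) (G : wdigraph R n).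

Definition adj : rel 'I_n := [rel u v | (u, v) \in edges G].

Fixpoint path_weight (u : 'I_n) (p : seq 'I_n) : R :=
  if p is v :: p' then weight G u v + path_weight v p' else 0.

(* +oo when v is not reachable from u. *)
Definition dist (u v : 'I_n) : \bar R :=
  ereal_inf [set (path_weight u p)%:E | p in
              [set p | path adj u p /\ last u p = v]].

Definition roundtrip (u v : 'I_n) : \bar R := (dist u v + dist v u)%E.

End Distance.

Inductive direction := Out | In.

Definition center_dist (R : realType) (n : nat) (dir : direction)
    (G : wdigraph R n) (c v : 'I_n) : \bar R :=
  match dir with Out => dist G c v | In => dist G v c end.

(* [A v = Some c]: v is assigned to the cluster centered at c;
   [A v = None]: v is not assigned and falls in the last cluster V_d. *)
Definition clustering (n : nat) := 'I_n -> option 'I_n.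

Section Clustering.
Variables (R : realType) (n : nat) (dir : direction) (G : wdigraph R n).

Definition cluster_of (A : clustering n) (c : 'I_n) : {set 'I_n} :=
  [set v | A v == Some c].

Definition last_cluster (A : clustering n) : {set 'I_n} :=
  [set v | A v == None].

Definition same_cluster (A : clustering n) (u v : 'I_n) : bool :=
  [exists c, (u \in cluster_of A c) && (v \in cluster_of A c)]
  || (u \in last_cluster A) && (v \in last_cluster A).

Definition cluster_radius (A : clustering n) (c : 'I_n) : \bar R :=
  \big[maxe/0%E]_(v in cluster_of A c) center_dist dir G c v.

(* [A] is an outcome of the procedure when the numbers drawn are
   [rho u], u \in U.  The center maximizing rho u - d(u, v) need not be
   unique; this is a relation so as to allow every way of breaking ties. *)
Definition cluster_outcome (U : {set 'I_n}) (rho : 'I_n -> R)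
    (A : clustering n) : Prop :=
  let key c v := ((rho c)%:E - center_dist dir G c v)%E in
  forall v, match A v with
  | Some c => [/\ c \in U, (0 < key c v)%E &
                 forall c', c' \in U -> (key c' v <= key c v)%E]
  | None => forall c, c \in U -> (key c v <= 0)%E
  end.

End Clustering.

Definition cluster_rate (R : realType) (s : nat) (r : R) : R := ln s%:R / r.

Section Probability.
Variables (R : realType) (d : measure_display) (T : measurableType d).
Variable P : probability T R.

Definition mutually_independent (I : finType) (U : {set I})
    (X : I -> {RV P >-> R}) : Prop :=
  forall (J : {set I}) (B : I -> set R), J \subset U ->
    (forall i, measurable (B i)) ->
    P (\bigcap_(i in [set i | i \in J]) (X i @^-1` B i)) =
    (\prod_(i in J) P (X i @^-1` B i))%E.

Definition iid_exponential (I : finType) (U : {set I}) (beta : R)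
    (X : I -> {RV P >-> R}) : Prop :=
  mutually_independent U X /\
  forall u B, u \in U -> measurable B ->
    distribution P (X u) B = exponential_prob beta B.

(* "E holds with probability at least p".  For measurable E this is
   p <= P E; the general form is needed because an arbitrary tie-breaking
   rule may make E differ from a measurable set on the null set of ties. *)
Definition prob_at_least (E : set T) (p : R) : Prop :=
  exists B, [/\ measurable B, B `<=` E & (p%:E <= P B)%E].

End Probability.

(** * A real RAM with exponential variates

  A program works on arrays of natural numbers and arrays of reals, named by
  the constants [a] below (a scalar is a one-cell array).  Programs are
  finite and cannot contain real constants other than numerals.  An assignment,
  a draw, or the evaluation of a test costs one time unit; the expressions
  involved have a size fixed by the program, so charging them by size would
  only change running times by a constant factor. *)

Inductive iexp :=
| INum of nat
| IGet (a : nat) of iexp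
| IAdd of iexp & iexp
| ISub of iexp & iexp
| IHalf of iexp.

Inductive rexp :=
| RNum of nat
| RGet (a : nat) of iexp
| RAdd of rexp & rexp
| RSub of rexp & rexp
| RDiv of rexp & rexp
| RLn of rexp.

Inductive bexp :=
| BIlt of iexp & iexp
| BRlt of rexp & rexp
| BNot of bexp
| BAnd of bexp & bexp.

Inductive cmd :=
| Skip
| ISet (a : nat) of iexp & iexp
| RSet (a : nat) of iexp & rexp
| Draw (a : nat) of iexp & rexp
| Seq of cmd & cmd
| If of bexp & cmd & cmd
| While of bexp & cmd.

Record state (R : realType) := State {
  imem : nat -> nat -> nat;
  rmem : nat -> nat -> R;
  drawn : nat }.

Definition upd (T : Type) (f : nat -> nat -> T) (a i : nat) (x : T) :
    nat -> nat -> T :=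
  fun b j => if (b == a) && (j == i) then x else f b j.

Section Semantics.
Variable R : realType.
Implicit Types st : state R.

Fixpoint ieval st (e : iexp) : nat :=
  match e with
  | INum k => k
  | IGet a e => imem st a (ieval st e)
  | IAdd e1 e2 => (ieval st e1 + ieval st e2)%N
  | ISub e1 e2 => (ieval st e1 - ieval st e2)%N
  | IHalf e => (ieval st e)./2
  end.

Fixpoint reval st (e : rexp) : R :=
  match e with
  | RNum k => k%:R
  | RGet a e => rmem st a (ieval st e)
  | RAdd e1 e2 => reval st e1 + reval st e2
  | RSub e1 e2 => reval st e1 - reval st e2
  | RDiv e1 e2 => reval st e1 / reval st e2
  | RLn e => ln (reval st e)
  end.

Fixpoint beval st (b : bexp) : bool :=
  match b with
  | BIlt e1 e2 => (ieval st e1 < ieval st e2)%N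
  | BRlt e1 e2 => reval st e1 < reval st e2
  | BNot b => ~~ beval st b
  | BAnd b1 b2 => beval st b1 && beval st b2
  end.

(* [draws k beta] is the value returned by the k-th draw (from 0) of the run
   if it asks for an Exp(beta) variate. *)
Variable draws : nat -> R -> R.

(* [exec c st t st']: run from [st], [c] halts in [st'] after time [t]. *)
Inductive exec : cmd -> state R -> nat -> state R -> Prop :=
| exec_skip st : exec Skip st 1 st
| exec_iset a i e st :
    exec (ISet a i e) st 1
      (State (upd (imem st) a (ieval st i) (ieval st e)) (rmem st) (drawn st))
| exec_rset a i e st :
    exec (RSet a i e) st 1
      (State (imem st) (upd (rmem st) a (ieval st i) (reval st e)) (drawn st))
| exec_draw a i e st :
    exec (Draw a i e) st 1
      (State (imem st)
         (upd (rmem st) a (ieval st i) (draws (drawn st) (reval st e)))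
         (drawn st).+1)
| exec_seq c1 c2 st1 t1 st2 t2 st3 :
    exec c1 st1 t1 st2 -> exec c2 st2 t2 st3 ->
    exec (Seq c1 c2) st1 (t1 + t2) st3
| exec_if b c1 c2 st t st' :
    exec (if beval st b then c1 else c2) st t st' ->
    exec (If b c1 c2) st t.+1 st'
| exec_while_done b c st :
    ~~ beval st b -> exec (While b c) st 1 st
| exec_while_step b c st1 t1 st2 t2 st3 :
    beval st1 b -> exec c st1 t1 st2 -> exec (While b c) st2 t2 st3 ->
    exec (While b c) st1 (t1 + t2).+1 st3.

End Semantics.

(* Cells that hold no input are 0.  Natural arrays:
   0 = [n; m; |U|], 1 = edge sources, 2 = edge targets, 3 = the elements of U;
   real arrays: 0 = edge weights, 1 = [r; s]. *)
Definition input_state (R : realType) (n : nat) (G : wdigraph R n)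
    (es : seq ('I_n * 'I_n)) (us : seq 'I_n) (r : R) (s : nat) : state R :=
  State
    (fun a i => nth 0%N (nth [::] [:: [:: n; size es; size us];
                                      [seq val e.1 | e <- es];
                                      [seq val e.2 | e <- es];
                                      [seq val u | u <- us]] a) i)
    (fun a i => nth 0 (nth [::] [:: [seq weight G e.1 e.2 | e <- es];
                                    [:: r; s%:R]] a) i)
    0%N.

(* Natural array 4: for each vertex v, c + 1 if its center is c, and 0 if v is
   not assigned. *)
Definition output_clustering (R : realType) (n : nat) (st : state R)
    (A : clustering n) : Prop :=
  forall v : 'I_n,
    imem st 4 v = if A v is Some c then (val c).+1 else 0%N.

(* Main.v *)
Require Import Defs.
From HB Require Import structures.
From mathcomp Require Import all_boot all_order all_algebra.
From mathcomp Require Import all_classical all_reals all_analysis.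
From mathcomp Require Import measurable_realfun lra ring zify.

Set Implicit Arguments.
Unset Strict Implicit.
Unset Printing Implicit Defensive.
Import Order.TTheory GRing.Theory Num.Theory.
Import numFieldNormedType.Exports.
Local Open Scope classical_set_scope.
Local Open Scope ring_scope.

(* Fix u, v with d(u,v) + d(v,u) <= rad and let a c be the smaller of the
   distances between c and u, v; the other one is at most a c + rad.  If every
   X c <= a c, both vertices are unassigned; if some X c - a c exceeds 0 and all
   other X c' - a c' by more than rad, both join c.  Some c always attains the
   maximum of all X c - a c unless none of them is positive, and since the rivals of
   c are independent of X c, memorylessness bounds the probability that c leads
   by at most exp (beta rad) times the probability that it leads by more than
   rad.  Summing over c gives 1 <= exp (beta rad) P(same cluster).

   The program runs Dijkstra's algorithm from all centers at once: a center c
   starts at min(0, -rho c), every other vertex at 0, and a vertex whose final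
   value is 0 is unassigned.  A vertex is settled only while the minimum is negative,
   so that a binary tree of minima gives O((n + m) log n). *)

(** * Shortest-path distances and potentials *)

Section DistanceTheory.
Variables (R : realType) (n : nat) (G : wdigraph R n).
Implicit Types u v w : 'I_n.

Lemma path_weight_ge0 u p : path (adj G) u p -> 0 <= path_weight G u p.
Proof.
elim: p u => //= v p IHp u /andP[uv vp].
by rewrite addr_ge0 ?IHp // weight_ge0.
Qed.

Lemma path_weight_cat u p q :
  path_weight G u (p ++ q) = path_weight G u p + path_weight G (last u p) q.
Proof. by elim: p u => [|v p IHp] u /=; rewrite ?add0r // IHp addrA. Qed.

Lemma dist_ge0 u v : (0 <= dist G u v)%E.
Proof.
by apply: le_ereal_inf_tmp => _ [p [up _] <-]; rewrite lee_fin path_weight_ge0.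
Qed.

Lemma dist_le_path u p :
  path (adj G) u p -> (dist G u (last u p) <= (path_weight G u p)%:E)%E.
Proof. by move=> up; apply: ereal_inf_lbound; exists p. Qed.

Lemma dist_refl u : dist G u u = 0%E.
Proof. by apply/eqP; rewrite eq_le dist_ge0 (@dist_le_path u [::]). Qed.

Lemma dist_edge u v : (u, v) \in edges G -> (dist G u v <= (weight G u v)%:E)%E.
Proof.
move=> uv; have := @dist_le_path u [:: v].
by rewrite /= andbT addr0; apply.
Qed.

Lemma dist_triangle u v w : (dist G u w <= dist G u v + dist G v w)%E.
Proof.
have H p q : path (adj G) u p -> last u p = v -> path (adj G) v q ->
    last v q = w ->
    (dist G u w <= (path_weight G u p)%:E + (path_weight G v q)%:E)%E.
  move=> up <- vq <-; rewrite -EFinD -path_weight_cat -last_cat.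
  by apply: dist_le_path; rewrite cat_path up.
(* Once [dist G v w] is finite it can be moved across the inequality, and the two infima are bounded
   one at a time. *)
have [vw|vw] := eqVneq (dist G v w) +oo%E.
  by rewrite vw addey ?leey // gt_eqF // (lt_le_trans _ (dist_ge0 _ _)) ?ltNyr.
have fvw : dist G v w \is a fin_num by rewrite ge0_fin_numE ?dist_ge0 // ltey.
rewrite -leeBlDr //; apply: le_ereal_inf_tmp => _ [p [up pv] <-].
rewrite leeBlDr // -leeBlDl //; apply: le_ereal_inf_tmp => _ [q [vq qw] <-].
by rewrite leeBlDl //; exact: H.
Qed.

(** The edge inequalities telescope along every path. The values computed by the program form such a
    potential, which bounds the keys of all centers. *)
Lemma potential_le_dist (L : 'I_n -> R) u v :
  (forall x y, (x, y) \in edges G -> L y <= L x + weight G x y) ->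
  ((L v - L u)%:E <= dist G u v)%E.
Proof.
move=> H; apply: le_ereal_inf_tmp => _ [p [up <-] <-]; rewrite lee_fin.
elim: p u up => [|x p IHp] u /=; first by rewrite subrr.
by case/andP => ux xp; have := IHp _ xp; have := H _ _ ux; lra.
Qed.

Lemma potential_le_dist_rev (L : 'I_n -> R) u v :
  (forall x y, (x, y) \in edges G -> L x <= L y + weight G x y) ->
  ((L u - L v)%:E <= dist G u v)%E.
Proof.
move=> H.
have := @potential_le_dist (fun x => - L x) u v.
rewrite opprK addrC; apply => x y xy; have := H _ _ xy; lra.
Qed.

Lemma center_dist_ge0 dir c v : (0 <= center_dist dir G c v)%E.
Proof. by case: dir; exact: dist_ge0. Qed.

Lemma center_dist_refl dir c : center_dist dir G c c = 0%E.
Proof. by case: dir; exact: dist_refl. Qed.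

(** [Out] appends a path from [u] to [v], [In] prepends one from [v] to [u]; the round trip pays for
    either. *)
Lemma center_dist_roundtrip dir c u v :
  (center_dist dir G c v <= center_dist dir G c u + roundtrip G u v)%E.
Proof.
have uvuv := dist_ge0 u v; have vu := dist_ge0 v u.
case: dir => /=; rewrite /roundtrip.
  by apply: le_trans (dist_triangle c u v) _; rewrite leeD2l // leeDl.
rewrite addeC; apply: le_trans (dist_triangle v u c) _.
by rewrite leeD2r // leeDr.
Qed.

Lemma roundtripC u v : roundtrip G u v = roundtrip G v u.
Proof. by rewrite /roundtrip addeC. Qed.

End DistanceTheory.
(** * Exponential variables *)

Section RealProbability.
Variables (R : realType) (d : measure_display) (T : measurableType d).
Variable P : probability T R.
Implicit Types A B : set T.

(** Real-valued, so that linear and nonlinear real arithmetic apply. *)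
Definition pr A : R := fine (P A).

Lemma EFin_pr A : measurable A -> P A = (pr A)%:E.
Proof. by move=> mA; rewrite fineK // fin_num_measure. Qed.

Lemma pr_ge0 A : 0 <= pr A.
Proof. exact: fine_ge0. Qed.

Lemma pr_le A B : measurable A -> measurable B -> A `<=` B -> pr A <= pr B.
Proof.
by move=> mA mB AB; rewrite -lee_fin -!EFin_pr // le_measure ?inE.
Qed.

Lemma pr_le1 A : measurable A -> pr A <= 1.
Proof. by move=> mA; rewrite -lee_fin -EFin_pr // probability_le1. Qed.

Lemma prDI A B : measurable A -> measurable B ->
  pr A = pr (A `\` B) + pr (A `&` B).
Proof.
move=> mA mB; apply: EFin_inj; rewrite EFinD -!EFin_pr //.
- exact: measureDI.
- exact: measurableI.
- exact: measurableD.
Qed.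

Lemma prU_le A B : measurable A -> measurable B -> pr (A `|` B) <= pr A + pr B.
Proof.
move=> mA mB; rewrite -lee_fin EFinD -!EFin_pr //; last exact: measurableU.
exact: measureU2.
Qed.

Lemma prC A : measurable A -> pr (~` A) = 1 - pr A.
Proof.
move=> mA; apply: EFin_inj; rewrite EFinB -!EFin_pr //.
  exact: probability_setC.
exact: measurableC.
Qed.

Lemma measurable_bool (f : T -> bool) :
  measurable_fun setT f -> measurable [set w | f w].
Proof.
move=> mf; rewrite [X in measurable X](_ : _ = setT `&` f @^-1` [set true]).
  exact: mf.
by apply/seteqP; split=> w /=; [split|case].
Qed.

Lemma measurable_ltr (f g : T -> R) : measurable_fun setT f ->
  measurable_fun setT g -> measurable [set w | f w < g w].
Proof. by move=> mf mg; apply: measurable_bool; exact: measurable_fun_ltr. Qed.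

Lemma measurable_ler (f g : T -> R) : measurable_fun setT f ->
  measurable_fun setT g -> measurable [set w | f w <= g w].
Proof. by move=> mf mg; apply: measurable_bool; exact: measurable_fun_ler. Qed.

(** Union bound; the induction moves one [F i] at a time into [B]. *)
Lemma pr_cover (I : eqType) (s : seq I) (Q : pred I) (F : I -> set T) A B :
  measurable A -> measurable B -> (forall i, measurable (F i)) ->
  (forall w, A w -> ~ B w -> exists i, [/\ i \in s, Q i & F i w]) ->
  pr A <= pr B + \sum_(i <- s | Q i) pr (F i).
Proof.
move=> + + mF; elim: s A B => [|i s IHs] A B mA mB H.
  rewrite big_nil addr0; apply: pr_le => // w Aw.
  by apply: contrapT => /(H _ Aw)[? []].
have [Qi|nQi] := boolP (Q i); last first.
  rewrite big_cons (negbTE nQi); apply: IHs => // w Aw nBw.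
  have [j [+ Qj Fj]] := H w Aw nBw; rewrite inE => /orP[/eqP ji|sj].
    by rewrite -ji Qj in nQi.
  by exists j.
rewrite big_cons Qi addrA.
apply: le_trans (lerD (prU_le mB (mF i)) (lexx _)).
apply: IHs => [||w Aw nw]; [exact: mA|exact: measurableU|].
have nBw : ~ B w by move=> Bw; apply: nw; left.
have [j [+ Qj Fj]] := H w Aw nBw; rewrite inE => /orP[/eqP ji|sj].
  by case: nw; right; rewrite -ji.
by exists j.
Qed.

(** Additivity over disjoint events inside [A], by the same absorption of [F i] into [B]. *)
Lemma pr_packing (I : eqType) (s : seq I) (Q : pred I) (F : I -> set T) A B :
  measurable A -> measurable B -> (forall i, measurable (F i)) ->
  B `<=` A -> uniq s ->
  (forall i, i \in s -> Q i -> F i `<=` A `\` B) ->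
  (forall i j w, i \in s -> j \in s -> Q i -> Q j ->
    F i w -> F j w -> i = j) ->
  pr B + \sum_(i <- s | Q i) pr (F i) <= pr A.
Proof.
move=> + + mF; elim: s A B => [|i s IHs] A B mA mB BA /=.
  by move=> *; rewrite big_nil addr0 pr_le.
move=> /andP[nis us] H1 H2; rewrite big_cons.
have memS j : j \in s -> j \in i :: s by rewrite inE orbC => ->.
case: ifP => Qi; last first.
  by apply: IHs => // [j js|j k w js ks]; [apply: H1|apply: H2]; exact: memS.
have FA := H1 i (mem_head _ _) Qi.
have mBF : measurable (B `|` F i) by exact: measurableU.
have -> : pr B + (pr (F i) + \sum_(j <- s | Q j) pr (F j)) =
    pr (B `|` F i) + \sum_(j <- s | Q j) pr (F j).
  rewrite addrA; congr (_ + _); rewrite (prDI mBF mB) [in RHS]addrC.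
  rewrite [_ `&` B](_ : _ = B); last by apply/seteqP; split=> w /=; tauto.
  rewrite [_ `\` B](_ : _ = F i) //.
  apply/seteqP; split=> w /= => [|Fw]; first tauto.
  by have [Aw nBw] := FA w Fw; split=> //; right.
apply: IHs => // [w [/BA|/FA[]]|j js Qj w Fj|j k w js ks] //; last first.
  by apply: H2; exact: memS.
have [Aw nBw] := H1 j (memS _ js) Qj w Fj.
split=> // -[Bw|Fi] //.
by move: nis; rewrite (H2 i j w) ?js ?mem_head // memS.
Qed.

(* [Y] is compared with [X] on bins of width [h], on which [X] can be replaced
   by independent tail events. *)
Lemma memoryless (X Y : T -> R) (beta rad : R) :
  0 < beta -> 0 <= rad ->
  measurable_fun setT X -> measurable_fun setT Y ->
  (forall a, 0 <= a -> pr [set w | a < X w] = expR (- (beta * a))) ->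
  (forall a t, pr ([set w | a < X w] `&` [set w | Y w <= t]) =
               pr [set w | a < X w] * pr [set w | Y w <= t]) ->
  pr [set w | Y w <= X w] <=
  expR (beta * rad) * pr [set w | Y w + rad < X w].
Proof.
move=> b0 rad0 mX mY tail indep.
set A := [set w | Y w <= X w]; set G := [set w | Y w + rad < X w].
have mA : measurable A by exact: measurable_ler.
have mG : measurable G.
  by apply: measurable_ltr => //; apply: measurable_funD => //; exact: measurable_cst.
have mXa a : measurable [set w | a < X w].
  by apply: measurable_ltr => //; exact: measurable_cst.
have mYt t : measurable [set w | Y w <= t].
  by apply: measurable_ler => //; exact: measurable_cst.
(* Independence of half-lines passes to bins by subtraction. *)
have bin a t t' : t <= t' ->
    pr ([set w | a < X w] `&` ([set w | Y w <= t'] `\` [set w | Y w <= t])) =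
    pr [set w | a < X w] * pr ([set w | Y w <= t'] `\` [set w | Y w <= t]).
  move=> tt'.
  have E : [set w | Y w <= t'] `&` [set w | Y w <= t] = [set w | Y w <= t].
    by apply/seteqP; split=> w /= => [[] //|yt]; split=> //; exact: le_trans tt'.
  have H1 := prDI (mYt t') (mYt t); rewrite E in H1.
  have H2 := prDI (measurableI _ _ (mXa a) (mYt t')) (mYt t).
  rewrite -setIA E in H2; rewrite setIDA.
  have := indep a t; have := indep a t'; nra.
(* Induction on the number of bins; the extra [h] in the exponent is the error made by replacing [Y]
   by an end of its bin. *)
have step h N : 0 < h ->
    pr (A `&` [set w | Y w <= N%:R * h]) <=
    expR (beta * (rad + h)) * pr (G `&` [set w | Y w <= N%:R * h]).
  move=> h0; elim: N => [|N IHN].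
    rewrite mul0r.
    (* On [Y <= 0] the event [A] is bounded trivially, and [rad < X] alone forces [Y + rad < X]. *)
    have H1 : pr (A `&` [set w | Y w <= 0]) <= pr [set w | Y w <= 0].
      by apply: pr_le => //; exact: measurableI.
    have H2 : pr ([set w | rad < X w] `&` [set w | Y w <= 0]) <=
              pr (G `&` [set w | Y w <= 0]).
      apply: pr_le; [exact: measurableI|exact: measurableI|].
      by move=> w [] /= Xr Y0; split=> //; rewrite /G /=; lra.
    rewrite indep tail // in H2; apply: le_trans H1 _.
    have : expR (beta * (rad + h)) * (expR (- (beta * rad)) * pr [set w | Y w <= 0])
       <= expR (beta * (rad + h)) * pr (G `&` [set w | Y w <= 0]).
      by rewrite ler_pM2l ?expR_gt0.
    apply: le_trans; rewrite mulrA -expRD.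
    rewrite ler_peMl ?pr_ge0 //; apply: le_trans (expR_ge1Dx _); nra.
  set t := N%:R * h in IHN *; set t' := N.+1%:R * h.
  have tt' : t' = t + h by rewrite /t' /t -natr1 mulrDl mul1r.
  have t0 : 0 <= t by rewrite mulr_ge0 // ltW.
  set D := [set w | Y w <= t'] `\` [set w | Y w <= t].
  have mD : measurable D by exact: measurableD.
  have split_ C : measurable C -> pr (C `&` [set w | Y w <= t']) =
      pr (C `&` D) + pr (C `&` [set w | Y w <= t]).
    move=> mC; rewrite (prDI (measurableI _ _ mC (mYt t')) (mYt t)) -setIDA.
    congr (_ + pr _); rewrite -setIA; congr (_ `&` _).
    by apply/seteqP; split=> w /= => [[] //|yt]; split=> //; rewrite tt'; lra.
  rewrite !split_ // mulrDr; apply: lerD => //.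
  (* On the bin from [t] to [t'], [A] forces [t < X], while [t' + rad < X] suffices for [G]; the two
     tails differ by the factor [expR (beta * (rad + h))]. *)
  have H1 : pr (A `&` D) <= pr ([set w | t < X w] `&` D).
    apply: pr_le; [exact: measurableI|exact: measurableI|].
    move=> w [] Aw Dw; split=> //; case: Dw => /= _ /negP; rewrite -ltNge => H.
    by rewrite /A/= in Aw; exact: lt_le_trans Aw.
  have H2 : pr ([set w | t' + rad < X w] `&` D) <= pr (G `&` D).
    apply: pr_le; [exact: measurableI|exact: measurableI|].
    move=> w [] /= Xw Dw; split=> //; case: Dw => /= H _.
    by rewrite /G /=; lra.
  have bD a : pr ([set w | a < X w] `&` D) = pr [set w | a < X w] * pr D.
    by apply: bin; rewrite tt'; lra.
  rewrite !bD !tail // in H1 H2; last by rewrite tt'; lra.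
  apply: le_trans H1 _.
  have : expR (beta * (rad + h)) * (expR (- (beta * (t' + rad))) * pr D)
       <= expR (beta * (rad + h)) * pr (G `&` D).
    by rewrite ler_pM2l ?expR_gt0.
  apply: le_trans; rewrite mulrA -expRD tt'.
  by rewrite (_ : _ + _ = - (beta * t)) //; lra.
have bin_limit h : 0 < h -> pr A <= expR (beta * (rad + h)) * pr G.
  move=> h0; apply/ler_addgt0Pr => e e0.
  (* The part of [A] above the last bin has probability at most [expR (- (beta * (N%:R * h)))], and
     [1 + x <= expR x] makes this at most [e]. *)
  have [N HN] : exists N : nat, e^-1 <= beta * (N%:R * h).
    exists (Num.bound (e^-1 / (beta * h))).
    have ebh : 0 <= e^-1 / (beta * h) by rewrite divr_ge0 ?invr_ge0 ?mulr_ge0 // ltW.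
    have := archi_boundP ebh; rewrite ltr_pdivrMr ?mulr_gt0 // => /ltW.
    by rewrite mulrCA.
  rewrite (prDI mA (mYt (N%:R * h))) addrC; apply: lerD.
    apply: le_trans (step h N h0) _; rewrite ler_pM2l ?expR_gt0 //.
    by apply: pr_le => //; exact: measurableI.
  have Nh : 0 <= N%:R * h by rewrite mulr_ge0 // ltW.
  have : pr (A `\` [set w | Y w <= N%:R * h]) <= pr [set w | N%:R * h < X w].
    apply: pr_le => //; first exact: measurableD.
    move=> w [] /= Aw /negP; rewrite -ltNge => H.
    by rewrite /A/= in Aw; exact: lt_le_trans Aw.
  move/le_trans; apply; rewrite tail //.
  rewrite expRN invf_ple ?posrE ?expR_gt0 //; apply: le_trans HN _.
  have := expR_ge1Dx (beta * (N%:R * h)); lra.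
have -> : pr A = expR (beta * rad) * (expR (- (beta * rad)) * pr A).
  by rewrite mulrA -expRD subrr expR0 mul1r.
rewrite ler_pM2l ?expR_gt0 //; apply/ler_addgt0Pr => e e0.
have e1 : 0 < 1 + e by lra.
have l0 : 0 < ln (1 + e) by rewrite ln_gt0 //; lra.
(* For this bin width the error factor [expR (beta * h)] equals [1 + e], and [pr G <= 1] turns it
   into an additive [e]. *)
have h0 : 0 < ln (1 + e) / beta by rewrite divr_gt0.
have := bin_limit _ h0.
rewrite mulrDr [beta * (_ / _)]mulrC divfK ?gt_eqF // expRD lnK ?posrE //.
rewrite -mulrA -(@ler_pM2l _ (expR (- (beta * rad)))) ?expR_gt0 //.
rewrite [X in _ <= X]mulrA -expRD addNr expR0 mul1r.
have := pr_le1 mG; nra.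
Qed.

End RealProbability.

(** * Independent exponential variables and the lead of the largest one *)

Section IidExponential.
Variables (R : realType) (d : measure_display) (T : measurableType d).
Variable P : probability T R.
Variables (I : finType) (U : {set I}) (beta : R) (X : I -> {RV P >-> R}).
Hypotheses (beta_gt0 : 0 < beta) (iidX : iid_exponential U beta X).

Let mX i : measurable_fun setT (X i).
Proof. exact: measurable_funPT. Qed.

Lemma pr_exponential u (B : set R) : u \in U -> measurable B ->
  pr P (X u @^-1` B) = fine (exponential_prob beta B).
Proof. by move=> uU mB; have [_ E] := iidX; rewrite -(E u). Qed.

(** The closed form is available on [[0, a]]; the negative half-line is split off because the
    density vanishes there. *)
Lemma exponential_tail u a : u \in U -> 0 <= a ->
  pr P [set w | a < X u w] = expR (- (beta * a)).
Proof.
move=> uU a0.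
have E1 : [set w | a < X u w] = ~` (X u @^-1` `]-oo, a]).
  by apply/seteqP; split=> w /=; rewrite in_itv /= ltNge => /negP.
have mle : measurable (X u @^-1` `]-oo, a]) by exact: measurable_funPTI.
have mneg : measurable (X u @^-1` `]-oo, 0[) by exact: measurable_funPTI.
rewrite E1 prC // (prDI P mle mneg).
have -> : X u @^-1` `]-oo, a] `\` X u @^-1` `]-oo, 0[ = X u @^-1` `[0, a].
  apply/seteqP; split=> w /=; rewrite !in_itv /=.
    by move=> [-> /negP]; rewrite -leNgt => ->.
  by move=> /andP[x0 ->]; split=> //; apply/negP; rewrite -leNgt.
have -> : X u @^-1` `]-oo, a] `&` X u @^-1` `]-oo, 0[ = X u @^-1` `]-oo, 0[.
  apply/seteqP; split=> w /=; rewrite !in_itv /=; first by case.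
  by move=> x0; split=> //; exact: le_trans (ltW x0) a0.
rewrite !pr_exponential //.
have -> : exponential_prob beta `]-oo, 0[ = 0%E.
  apply: integral0_eq => x /=; rewrite in_itv /= => x0.
  by rewrite lt0_exponential_pdf.
(* For [a = 0] the interval is a single point, of measure 0. *)
move: a0; rewrite le_eqVlt => /orP[/eqP <-|a0].
  rewrite set_itv1 /exponential_prob integral_set1 /= addr0 subr0 mulr0.
  by rewrite oppr0 expR0.
by rewrite exponential_prob_itv0c //= addr0 opprB addrC subrK mulNr.
Qed.

(** Mutual independence is applied to [J] and to [c |: J], with [B] put at index [c]; the two
    products differ by one factor. *)
Lemma iid_independent c (J : {set I}) (B : set R) (C : I -> set R) :
  c \in U -> J \subset U -> c \notin J -> measurable B ->
  (forall i, measurable (C i)) ->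
  pr P ((X c @^-1` B) `&` \bigcap_(i in [set i | i \in J]) (X i @^-1` C i)) =
  pr P (X c @^-1` B) * pr P (\bigcap_(i in [set i | i \in J]) (X i @^-1` C i)).
Proof.
move=> cU JU cJ mB mC; have [indep _] := iidX.
pose F i := if i == c then B else C i.
have mF i : measurable (F i) by rewrite /F; case: ifP.
have cJU : c |: J \subset U by rewrite finset.subUset finset.sub1set cU.
have EJ i : i \in J -> F i = C i.
  by move=> iJ; rewrite /F; case: eqP => // ic; rewrite -ic iJ in cJ.
have EF : X c @^-1` B `&` \bigcap_(i in [set i | i \in J]) X i @^-1` C i =
    \bigcap_(i in [set i | i \in c |: J]) (X i @^-1` F i).
  apply/seteqP; split=> w.
    move=> [Bw Cw] i /=; rewrite in_setU1 => /orP[/eqP ->|iJ].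
      by rewrite /F eqxx.
    by rewrite EJ //; exact: Cw.
  move=> H; split; first by have := H c; rewrite /F /= eqxx; apply; rewrite setU11.
  by move=> i /= iJ; have := H i; rewrite /= EJ //; apply; rewrite setU1r.
rewrite /pr EF (indep (c |: J) F) // (indep J C) // big_setU1 //=.
rewrite {1}/F eqxx fineM ?fin_num_measure //.
- by congr (_ * fine _); apply: eq_bigr => i /EJ ->.
- exact: measurable_funPTI.
- rewrite (eq_bigr (fun i => P (X i @^-1` C i))) => [|i /EJ -> //].
  elim/big_ind: _ => // [x y|i _]; first exact: fin_numM.
  by rewrite fin_num_measure //; exact: measurable_funPTI.
Qed.

Variables (V : {set I}) (a : I -> R) (rad : R).
Hypotheses (VU : V \subset U) (rad_ge0 : 0 <= rad).

(** The default 0 of the maximum makes a lead over the rivals also a lead over 0, the threshold for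
    assignment. *)
Definition rival c w := \big[Num.max/0]_(i <- enum V | i != c) (X i w - a i).

Lemma rival_leP c w t :
  reflect (0 <= t /\ forall i, i \in V -> i != c -> X i w - a i <= t)
          (rival c w <= t).
Proof.
rewrite /rival; apply: (iffP idP) => [H|[t0 H]].
  split; first by apply: le_trans H; exact: bigmax_ge_id.
  move=> i iV ic; apply: le_trans H.
  by apply: (@le_bigmax_seq _ _ _ _ _ i); rewrite ?mem_enum.
rewrite big_seq_cond; apply: bigmax_le => // i.
by rewrite mem_enum => /andP[]; exact: H.
Qed.

Lemma rival_ge0 c w : 0 <= rival c w.
Proof. by have /rival_leP[] := lexx (rival c w). Qed.

Lemma measurable_rival c : measurable_fun setT (rival c).
Proof.
rewrite /rival; elim: (enum V) => [|i s IHs].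
  by under eq_fun do rewrite big_nil; exact: measurable_cst.
case ic : (i != c); last by under eq_fun do rewrite big_cons ic.
under eq_fun do rewrite big_cons ic.
by apply: measurable_maxr => //; apply: measurable_funB.
Qed.

Let mradr c : measurable_fun setT (fun w => rad + rival c w).
Proof. by apply: measurable_funD; [exact: measurable_cst|exact: measurable_rival]. Qed.

Let mXa c : measurable_fun setT (fun w => X c w - a c).
Proof. exact: measurable_funB. Qed.

Definition all_below := [set w | forall c, c \in V -> X c w <= a c].
Definition leads c := [set w | rad + rival c w < X c w - a c].

Lemma measurable_leads c : measurable (leads c).
Proof. exact: measurable_ltr. Qed.

Lemma measurable_all_below : measurable all_below.
Proof.
rewrite (_ : all_below = \bigcap_(c in [set c | c \in V]) [set w | X c w <= a c]).
  apply: fin_bigcap_measurable => [|c _]; first exact: finite_finset.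
  by apply: measurable_ler.
by apply/seteqP; split=> w H c cV; exact: H.
Qed.

(** [memoryless] with [Y] the rival value shifted by [a c]; this [Y] depends only on the variables
    other than [X c]. *)
Lemma pr_leads c : c \in V ->
  pr P [set w | rival c w <= X c w - a c] <= expR (beta * rad) * pr P (leads c).
Proof.
move=> cV; have cU := fintype.subsetP VU _ cV.
rewrite (_ : [set w | _] = [set w | rival c w + a c <= X c w]); last first.
  by apply/seteqP; split=> w /=; rewrite lerBrDr.
rewrite (_ : leads c = [set w | rival c w + a c + rad < X c w]); last first.
  by apply/seteqP; split=> w; rewrite /leads /=; lra.
apply: memoryless => //.
- by apply: measurable_funD => //; exact: measurable_rival.
- by move=> x x0; exact: exponential_tail.
(* Below [a c] the event is empty because [rival] is nonnegative; above, it is an intersection of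
   half-line events for the other indices. *)
move=> x t; have [tc|tc] := ltP t (a c).
  rewrite (_ : [set w | rival c w + a c <= t] = set0).
    by rewrite setI0 /pr measure0 mulr0.
  apply/seteqP; split=> w //=.
  by have := rival_ge0 c w; lra.
rewrite (_ : [set w | rival c w + a c <= t] = \bigcap_(i in [set i | i \in V :\ c])
    (X i @^-1` `]-oo, (t - a c + a i)])).
  have -> : [set w | x < X c w] = X c @^-1` `]x, +oo[.
    by apply/seteqP; split=> w /=; rewrite in_itv /= andbT.
  apply: iid_independent => //; last by rewrite setD11.
  by apply: fintype.subset_trans VU; exact: subD1set.
apply/seteqP; split=> w /=.
  rewrite -lerBrDr => /rival_leP[_ H] i; rewrite /= in_setD1 => /andP[ic iV].
  by rewrite in_itv /=; have := H i iV ic; lra.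
move=> H; rewrite -lerBrDr; apply/rival_leP; split=> [|i iV ic]; first lra.
by have := H i; rewrite /= in_setD1 ic in_itv /= => /(_ iV); lra.
Qed.

Lemma pr_separated :
  expR (- (beta * rad)) <=
  pr P (all_below `|` \bigcup_(c in [set c | c \in V]) leads c).
Proof.
have rad0 := rad_ge0; set E := _ `|` _.
have mE : measurable E.
  apply: measurableU; first exact: measurable_all_below.
  apply: fin_bigcup_measurable => [|c _]; first exact: finite_finset.
  exact: measurable_leads.
have leads_gt c i w : i \in V -> i != c -> leads c w -> X i w - a i < X c w - a c.
  move=> iV ic; rewrite /leads /=; have /rival_leP[r0 H] := lexx (rival c w).
  move=> lead_c; apply: le_lt_trans (H i iV ic) (le_lt_trans _ lead_c).
  by rewrite lerDr.
(* Two leaders would each strictly beat the other, and a leader contradicts [all_below], so the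
   events are disjoint. *)
have pack : pr P all_below + \sum_(c <- enum V | c \in V) pr P (leads c) <= pr P E.
  apply: pr_packing => //; try exact: measurable_all_below.
  - exact: measurable_leads.
  - by move=> w Ew; left.
  - exact: enum_uniq.
  - move=> c _ cV w lw; split; first by right; exists c.
    move=> /(_ c cV); move: lw; rewrite /leads /=.
    by have := rival_ge0 c w; lra.
  - move=> i j w _ _ iV jV li lj; apply: contrapT => /eqP ij.
    have := leads_gt _ _ _ iV ij lj; rewrite eq_sym in ij.
    by have := leads_gt _ _ _ jV ij li; lra.
have cover : pr P setT <= pr P all_below +
    \sum_(c <- enum V | c \in V) pr P [set w | rival c w <= X c w - a c].
  apply: pr_cover => //; first exact: measurable_all_below.
    by move=> c; apply: measurable_ler => //; exact: measurable_rival.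
  move=> w _ /existsNP[c0 /not_implyP[c0V /negP]]; rewrite -ltNge => Xc0.
  (* Some difference is positive, so a maximizing index weakly beats both 0 and its rivals. *)
  pose m := [arg max_(i > c0 in V) (X i w - a i)]%O.
  have [mV mmax] : m \in V /\ forall j, j \in V -> X j w - a j <= X m w - a m.
    by rewrite /m; case: arg_maxP => // i iV H; split.
  exists m; split=> //; first by rewrite mem_enum.
  apply/rival_leP; split=> [|i iV _]; last exact: mmax.
  by have := mmax _ c0V; lra.
rewrite {1}/pr probability_setT /= in cover.
have S : \sum_(c <- enum V | c \in V) pr P [set w | rival c w <= X c w - a c] <=
    expR (beta * rad) * \sum_(c <- enum V | c \in V) pr P (leads c).
  by rewrite mulr_sumr; apply: ler_sum => c cV; exact: pr_leads.
(* As the factor is at least 1, the [all_below] term can be multiplied by it too. *)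
have e1 : 1 <= expR (beta * rad) by rewrite -expR0 ler_expR mulr_ge0 // ltW.
rewrite expRN -[leLHS]mulr1 ler_pdivrMl ?expR_gt0 //.
have := pr_ge0 P all_below; nra.
Qed.

End IidExponential.
(** * Guarantees of the clustering *)

Section Outcome.
Variables (R : realType) (n : nat) (dir : direction) (G : wdigraph R n).
Variables (U V : {set 'I_n}) (rho a : 'I_n -> R) (rad : R) (A : clustering n).
Hypothesis outA : cluster_outcome dir G U rho A.

(** Both endpoints of a short round trip satisfy this with the same [a], so each can be treated
    alone. *)
Definition near_profile x := forall c, c \in U ->
  if c \in V then ((a c)%:E <= center_dist dir G c x <= (a c + rad)%:E)%E
  else center_dist dir G c x == +oo%E.

Lemma key_gt0 x c : near_profile x -> c \in U ->
  (0 < (rho c)%:E - center_dist dir G c x)%E ->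
  c \in V /\ ((rho c)%:E - center_dist dir G c x <= (rho c - a c)%:E)%E.
Proof.
move=> nx cU key0; have := nx c cU; case: ifP => [_ /andP[ax _]|_ /eqP D].
  by split=> //; rewrite EFinB leeB.
by rewrite D /= in key0.
Qed.

Lemma unassigned_all_below x : near_profile x ->
  (forall c, c \in V -> rho c <= a c) -> A x = None.
Proof.
move=> nx below; have := outA x; case: (A x) => // c [cU key0 _].
have [cV] := key_gt0 nx cU key0; move/(lt_le_trans key0).
by rewrite lte_fin subr_gt0 ltNge below.
Qed.

(** The key of [c] at [x] is at least [rho c - a c - rad], that of a rival at most [rho c' - a c'].
    The lead is strict, so no tie arises. *)
Lemma assigned_leader x c : near_profile x -> c \in U -> c \in V ->
  rad < rho c - a c ->
  (forall c', c' \in V -> c' != c -> rho c' - a c' + rad < rho c - a c) ->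
  A x = Some c.
Proof.
move=> nx cU cV lead0 lead.
have kc : ((rho c - a c - rad)%:E <= (rho c)%:E - center_dist dir G c x)%E.
  have := nx c cU; rewrite cV => /andP[_ xa].
  by rewrite -addrA -opprD EFinB leeB.
have := outA x; case: (A x) => [c'|] H; last first.
  have H0 : (rho c - a c - rad <= 0) by rewrite -lee_fin; apply: le_trans kc (H c cU).
  by rewrite leNgt subr_gt0 lead0 in H0.
case: H => c'U key0 kmax; apply/eqP/negPn/negP => cc'.
have [c'V kc'] := key_gt0 nx c'U key0.
have := le_trans kc (le_trans (kmax c cU) kc').
rewrite lee_fin => H1; have /(_ c'V cc') H2 := lead c'.
by rewrite lerBlDr leNgt H2 in H1.
Qed.

(** A vertex joins [x] only with a positive key, hence at distance below [rho x]. *)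
Lemma cluster_radius_le x t : 0 <= t -> rho x <= t ->
  (cluster_radius dir G A x <= t%:E)%E.
Proof.
move=> t0 xt; apply: bigmax_le => [|v]; first by rewrite lee_fin.
rewrite inE => /eqP Av; have := outA v; rewrite Av => -[_ + _].
rewrite sube_gt0 => /ltW /le_trans; apply.
by rewrite lee_fin.
Qed.

(** Every [u] in [U] has the positive key [rho u] at itself, so it is assigned. *)
Lemma last_cluster_le : (forall u, u \in U -> 0 < rho u) ->
  (#|last_cluster A| <= n - #|U|)%N.
Proof.
move=> rho0; have -> : (n - #|U| = #|~: U|)%N by rewrite [in RHS]cardsCs finset.setCK card_ord.
apply: subset_leq_card.
apply/fintype.subsetP => v; rewrite !inE => /eqP Av; apply/negP => vU.
have := outA v; rewrite Av => /(_ v vU).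
by rewrite center_dist_refl sube0 lee_fin leNgt rho0.
Qed.

End Outcome.

Section Guarantees.
Variables (R : realType) (n : nat) (dir : direction) (G : wdigraph R n).
Variables (U : {set 'I_n}) (s : nat) (r : R).
Variables (d : measure_display) (T : measurableType d) (P : probability T R).
Variables (X : 'I_n -> {RV P >-> R}) (A : T -> clustering n).
Hypotheses (s_gt1 : (1 < s)%N) (r_gt0 : 0 < r).
Hypothesis iidX : iid_exponential U (cluster_rate s r) X.
Hypothesis outA :
  forall w, cluster_outcome dir G U (fun u => X u w) (A w).

Let mX i : measurable_fun setT (X i).
Proof. exact: measurable_funPT. Qed.

Lemma cluster_rate_gt0 : 0 < cluster_rate s r.
Proof. by rewrite divr_gt0 // ln_gt0 // ltr1n. Qed.

Lemma radius_guarantee c : 1 <= c ->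
  prob_at_least P
    [set w | forall x : 'I_n, x \in U ->
               (cluster_radius dir G (A w) x <= (c * r)%:E)%E]
    (1 - n%:R / s%:R `^ c).
Proof.
move=> c1; have cr0 : 0 <= c * r by rewrite mulr_ge0 ?ltW // (lt_le_trans ltr01).
exists (\bigcap_(u in [set u | u \in U]) [set w | X u w <= c * r]).
have mB : measurable (\bigcap_(u in [set u | u \in U]) [set w | X u w <= c * r]).
  apply: fin_bigcap_measurable => [|u _]; first exact: finite_finset.
  by apply: measurable_ler.
split=> // [w Xw x xU|].
  by apply: (cluster_radius_le (outA w)) => //; exact: Xw.
rewrite EFin_pr // lee_fin lerBlDr.
set B := \bigcap_(u in _) _.
have : pr P setT <= pr P B +
    \sum_(u <- enum 'I_n | u \in U) pr P [set w | c * r < X u w].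
  apply: pr_cover => // [u|w _ /existsNP[u /not_implyP[uU /negP]]].
    exact: measurable_ltr.
  by rewrite -ltNge => Xu; exists u; rewrite mem_enum.
rewrite {1}/pr probability_setT /= => /le_trans; apply.
rewrite lerD2l.
(* One term per vertex; those in [U] equal the tail [expR (- (beta * (c * r)))], the others are only
   nonnegative. *)
have -> : n%:R / s%:R `^ c = \sum_(u <- enum 'I_n) (s%:R `^ c)^-1 :> R.
  by rewrite big_enum /= sumr_const card_ord mulr_natl.
rewrite big_mkcond; apply: ler_sum => u _; case: ifP => uU; last first.
  by rewrite invr_ge0 powR_ge0.
rewrite (exponential_tail iidX) // -powRN /powR pnatr_eq0 gtn_eqF 1?ltnW //.
rewrite ler_expR /cluster_rate mulNr lerN2 mulrCA.
by rewrite divfK ?gt_eqF.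
Qed.

(** The exceptional null set is the event that some draw is not positive. *)
Lemma last_cluster_guarantee :
  {ae P, forall w : T, (#|last_cluster (A w)| <= n - #|U|)%N}.
Proof.
exists (\bigcup_(u in [set u | u \in U]) [set w | X u w <= 0]).
have mF u : measurable [set w | X u w <= 0] by exact: measurable_ler.
have mB : measurable (\bigcup_(u in [set u | u \in U]) [set w | X u w <= 0]).
  by apply: fin_bigcup_measurable => [|u _]; first exact: finite_finset.
split=> // [|w /= nw]; last first.
  apply: contrapT => H; apply: nw; apply: (last_cluster_le (outA w)) => u uU.
  by rewrite ltNge; apply/negP => Xu; apply: H; exists u.
rewrite EFin_pr //; congr (_%:E); apply/eqP; rewrite eq_le pr_ge0 andbT.
have E0 : 0 = pr P set0 + \sum_(u <- enum 'I_n | u \in U) pr P [set w | X u w <= 0].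
  rewrite {1}/pr measure0 /= add0r big1 // => u uU.
  rewrite (_ : [set w | _] = ~` [set w | 0 < X u w]); last first.
    by apply/seteqP; split=> w /=; rewrite leNgt => /negP.
  rewrite prC; last exact: measurable_ltr.
  by rewrite (exponential_tail iidX) // mulr0 oppr0 expR0 subrr.
rewrite [leRHS]E0.
apply: pr_cover => // w [u /= uU Xu] _; exists u; by rewrite mem_enum.
Qed.

Lemma same_cluster_guarantee u v rad : 0 < rad ->
  (roundtrip G u v <= rad%:E)%E ->
  prob_at_least P [set w | same_cluster (A w) u v]
    (expR (- (rad / r * ln s%:R))).
Proof.
move=> rad0 uv.
(* The round trip is finite, so a center is at finite distance from both [u] and [v] or from
   neither; [V] collects the former, for which [fine] loses nothing. *)
pose V := [set c in U | (center_dist dir G c u < +oo)%E].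
pose a c := Num.min (fine (center_dist dir G c u)) (fine (center_dist dir G c v)).
have VU : V \subset U by apply/fintype.subsetP => c; rewrite inE => /andP[].
have vu : (roundtrip G v u <= rad%:E)%E by rewrite roundtripC.
have Duv c : (center_dist dir G c v <= center_dist dir G c u + rad%:E)%E.
  by apply: le_trans (center_dist_roundtrip G dir c u v) _; rewrite leeD2l.
have Dvu c : (center_dist dir G c u <= center_dist dir G c v + rad%:E)%E.
  by apply: le_trans (center_dist_roundtrip G dir c v u) _; rewrite leeD2l.
have near c : c \in U -> if c \in V then
    ((a c)%:E <= center_dist dir G c u <= (a c + rad)%:E)%E /\
    ((a c)%:E <= center_dist dir G c v <= (a c + rad)%:E)%E
    else center_dist dir G c u == +oo%E /\ center_dist dir G c v == +oo%E.
  move=> cU; rewrite inE cU /= /a.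
  have := center_dist_ge0 G dir c u; have := center_dist_ge0 G dir c v.
  move: (Duv c) (Dvu c).
  case: (center_dist dir G c u) => [x| |] //; case: (center_dist dir G c v) => [y| |] //=.
  rewrite ltry -!EFinD !lee_fin => yx xy _ _.
  by case: (leP x y); split; apply/andP; split; lra.
pose E := all_below X V a `|` \bigcup_(c in [set c | c \in V]) leads X V a rad c.
have mE : measurable E.
  apply: measurableU; first exact: measurable_all_below.
  apply: fin_bigcup_measurable => [|c _]; first exact: finite_finset.
  exact: measurable_leads.
exists E; split=> //; last first.
  rewrite EFin_pr // lee_fin mulrAC.
  have -> : rad * ln s%:R / r = cluster_rate s r * rad
    by rewrite /cluster_rate [RHS]mulrAC [rad * _]mulrC.
  by apply: pr_separated VU (ltW rad0) => //; exact: cluster_rate_gt0.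
have nu : near_profile dir G U V a rad u.
  by move=> c /near; case: ifP => _ [].
have nv : near_profile dir G U V a rad v.
  by move=> c /near; case: ifP => _ [].
move=> w [below|[c /= cV lead]]; rewrite /same_cluster /=.
  by rewrite !inE (unassigned_all_below (outA w) nu below)
    (unassigned_all_below (outA w) nv below) orbT.
have cU := fintype.subsetP VU _ cV.
have r0 := rival_ge0 X V a c w.
have lead0 : rad < X c w - a c by rewrite /leads /= in lead; lra.
have leadV c' : c' \in V -> c' != c -> X c' w - a c' + rad < X c w - a c.
  move=> c'V c'c; have /rival_leP[_ /(_ c' c'V c'c)] := lexx (rival X V a c w).
  by rewrite /leads /= in lead; lra.
apply/orP; left; apply/existsP; exists c.
by rewrite !inE (assigned_leader (outA w) nu cU cV lead0 leadV)
  (assigned_leader (outA w) nv cU cV lead0 leadV) eqxx.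
Qed.

End Guarantees.
(** * Running time *)

Section TotalCorrectness.
Variables (R : realType) (draws : nat -> R -> R).
Implicit Types (st : state R) (Q : nat -> state R -> Prop).

(** Weakest precondition for total correctness, with the running time visible to the
    postcondition. *)
Definition wp c st Q := exists t st', exec draws c st t st' /\ Q t st'.

Lemma wp_mono c st Q Q' : (forall t st', Q t st' -> Q' t st') ->
  wp c st Q -> wp c st Q'.
Proof. by move=> QQ' [t [st' [e q]]]; exists t, st'; split=> //; exact: QQ'. Qed.

Lemma wp_skip st Q : Q 1%N st -> wp Skip st Q.
Proof. by exists 1%N, st; split=> //; constructor. Qed.

Lemma wp_iset a i e st Q :
  Q 1%N (State (upd (imem st) a (ieval st i) (ieval st e)) (rmem st) (drawn st)) ->
  wp (ISet a i e) st Q.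
Proof. by move=> q; do 2!eexists; split; [exact: exec_iset|]. Qed.

Lemma wp_rset a i e st Q :
  Q 1%N (State (imem st) (upd (rmem st) a (ieval st i) (reval st e)) (drawn st)) ->
  wp (RSet a i e) st Q.
Proof. by move=> q; do 2!eexists; split; [exact: exec_rset|]. Qed.

Lemma wp_draw a i e st Q :
  Q 1%N (State (imem st)
         (upd (rmem st) a (ieval st i) (draws (drawn st) (reval st e)))
         (drawn st).+1) ->
  wp (Draw a i e) st Q.
Proof. by move=> q; do 2!eexists; split; [exact: exec_draw|]. Qed.

Lemma wp_seq c1 c2 st Q :
  wp c1 st (fun t1 st1 => wp c2 st1 (fun t2 => Q (t1 + t2)%N)) ->
  wp (Seq c1 c2) st Q.
Proof.
move=> [t1 [st1 [e1 [t2 [st2 [e2 q]]]]]].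
by exists (t1 + t2)%N, st2; split=> //; exact: exec_seq e1 e2.
Qed.

Lemma wp_if b c1 c2 st Q :
  (beval st b -> wp c1 st (fun t => Q t.+1)) ->
  (~~ beval st b -> wp c2 st (fun t => Q t.+1)) ->
  wp (If b c1 c2) st Q.
Proof.
case E : (beval st b) => H1 H2.
  have [t [st' [e q]]] := H1 isT.
  by exists t.+1, st'; split=> //; apply: exec_if; rewrite E.
have [t [st' [e q]]] := H2 isT.
by exists t.+1, st'; split=> //; apply: exec_if; rewrite E.
Qed.

(** [p] is an amortized time budget. The strict decrease pays for each successful test, the final
    successor for the failing one. *)
Lemma wp_while (Inv : nat -> state R -> Prop) b c p st :
  (forall p st, Inv p st -> beval st b ->
     wp c st (fun t st' => exists p', Inv p' st' /\ (p' + t < p)%N)) ->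
  Inv p st ->
  wp (While b c) st
    (fun t st' => exists p', [/\ Inv p' st', ~~ beval st' b & (t + p' <= p.+1)%N]).
Proof.
move=> step; have [k] := ubnP p; elim: k p st => // k IHk p st pk Ist.
have [bst|nb] := boolP (beval st b); last first.
  by exists 1%N, st; split; [exact: exec_while_done|exists p; split].
have [t1 [st1 [e1 [p1 [I1 pt1]]]]] := step p st Ist bst.
have [|t2 [st2 [e2 [p2 [I2 nb2 pt2]]]]] := IHk p1 st1 _ I1; first by lia.
exists (t1 + t2).+1, st2; split; first exact: exec_while_step bst e1 e2.
by exists p2; split=> //; lia.
Qed.

Lemma upd_other (T : Type) (f : nat -> nat -> T) a i x b :
  b != a -> upd f a i x b = f b.
Proof. by move=> /negbTE ba; rewrite /upd ba. Qed.

Definition frame (ia ra : seq nat) st st' :=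
  [/\ forall a, a \notin ia -> imem st' a = imem st a,
      forall a, a \notin ra -> rmem st' a = rmem st a &
      drawn st' = drawn st].

Lemma frame_refl ia ra st : frame ia ra st st.
Proof. by []. Qed.

Lemma frame_trans ia ra st1 st2 st3 :
  frame ia ra st1 st2 -> frame ia ra st2 st3 -> frame ia ra st1 st3.
Proof.
by move=> [i1 r1 d1] [i2 r2 d2]; split=> [a ai|a ar|];
  rewrite ?i2 ?i1 ?r2 ?r1 ?d2 ?d1.
Qed.

Lemma frame_sub ia ra ia' ra' st st' :
  {subset ia <= ia'} -> {subset ra <= ra'} -> frame ia ra st st' ->
  frame ia' ra' st st'.
Proof.
by move=> si sr [i r dr]; split=> // a na; [apply: i|apply: r];
  apply: contra na; [exact: si|exact: sr].
Qed.

(** Gives the target state the constructor form that [frame_iset] and [frame_rset] match. *)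
Lemma frame_eta ia ra st st' : frame ia ra st st' ->
  frame ia ra st (State (imem st') (rmem st') (drawn st')).
Proof. by []. Qed.

Lemma frame_iset ia ra st im rm dr a i x : a \in ia ->
  frame ia ra st (State im rm dr) ->
  frame ia ra st (State (upd im a i x) rm dr).
Proof.
move=> aia [fi fr fd]; split=> //= b bia; rewrite upd_other //; last first.
  by apply: contraNneq bia => ->.
exact: fi.
Qed.

Lemma frame_rset ia ra st im rm dr a i x : a \in ra ->
  frame ia ra st (State im rm dr) ->
  frame ia ra st (State im (upd rm a i x) dr).
Proof.
move=> ara [fi fr fd]; split=> //= b bra; rewrite upd_other //; last first.
  by apply: contraNneq bra => ->.
exact: fr.
Qed.

End TotalCorrectness.

(* Node i of a heap-shaped tree has children 2i and 2i+1, the leaves are the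
   nodes n, ..., 2n-1, and every inner node holds the minimum of its children;
   node 1 is the root, also when n is not a power of two. *)
Section MinTree.
Variables (R : realType) (n : nat).
Implicit Types (K : nat -> R) (i j : nat).

Definition min_node K j := K j = Num.min (K j.*2) (K j.*2.+1).

Definition min_tree_except i K :=
  forall j, (0 < j < n)%N -> j != i -> min_node K j.

(** Index 0 is no node, so nothing is exempted; it is also the half of 1, where a repair that has
    passed the root ends. *)
Definition min_tree := min_tree_except 0.

Lemma min_tree_root_le K j : min_tree K -> (0 < j < n.*2)%N -> K 1%N <= K j.
Proof.
move=> H; have [k] := ubnP j; elim: k j => // k IHk j jk jn.
have [j1|j1] := leqP j 1; first by have -> : j = 1%N by lia.
have hn : (0 < j./2 < n)%N by lia.
have Hh := H j./2 hn; apply: le_trans (IHk j./2 _ _) _; try lia.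
rewrite Hh ?gtn_eqF //; last by lia.
have /orP[/eqP E|/eqP E] : (j == j./2.*2) || (j == j./2.*2.+1) by lia.
  by rewrite -E ge_min lexx.
by rewrite -E ge_min lexx orbT.
Qed.

Lemma min_tree_update i K x : min_tree K -> (n <= i)%N ->
  min_tree_except i./2 (fun j => if j == i then x else K j).
Proof.
move=> H ni j jn ji; rewrite /min_node.
have -> : (j == i) = false by lia.
have -> : (j.*2 == i) = false by lia.
have -> : (j.*2.+1 == i) = false by lia.
by apply: H => //; lia.
Qed.

(** Recomputing node [i] repairs it and can break only its parent. *)
Lemma min_tree_fix i K : (0 < i)%N -> min_tree_except i K ->
  min_tree_except i./2
    (fun j => if j == i then Num.min (K i.*2) (K i.*2.+1) else K j).
Proof.
move=> i0 H j jn ji; rewrite /min_node.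
have [->|jni] := eqVneq j i.
  have -> : (i.*2 == i) = false by lia.
  by have -> : (i.*2.+1 == i) = false by lia.
have -> : (j.*2 == i) = false by lia.
have -> : (j.*2.+1 == i) = false by lia.
exact: H.
Qed.

End MinTree.

(** * Programs on the tree of minima *)

Definition Var a := IGet a (INum 0).
Definition N := IGet 0 (INum 0).
Definition RVar a := RGet a (INum 0).

Definition sift_up :=
  let left := IAdd (Var 7) (Var 7) in
  let right := IAdd left (INum 1) in
  While (BIlt (INum 1) (Var 7))
    (Seq (ISet 7 (INum 0) (IHalf (Var 7)))
      (If (BRlt (RGet 3 left) (RGet 3 right))
        (RSet 3 (Var 7) (RGet 3 left))
        (RSet 3 (Var 7) (RGet 3 right)))).

Definition set_leaf v x :=
  Seq (ISet 7 (INum 0) (IAdd N v)) (Seq (RSet 3 (Var 7) x) sift_up).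

(** A node smaller than its left child must equal its right child, so each step preserves the value
    of the root. *)
Definition descend :=
  let left := IAdd (Var 7) (Var 7) in
  Seq (ISet 7 (INum 0) (INum 1))
    (While (BIlt (Var 7) N)
      (If (BRlt (RGet 3 (Var 7)) (RGet 3 left))
        (ISet 7 (INum 0) (IAdd left (INum 1)))
        (ISet 7 (INum 0) left))).

Section TreePrograms.
Variables (R : realType) (draws : nat -> R -> R) (n : nat).
Hypothesis n_gt0 : (0 < n)%N.
Implicit Types (st : state R) (Q : nat -> state R -> Prop).

Local Notation lg := (trunc_log 2 n.*2).

(** A round costs 4, test included, and halving the node lowers its [trunc_log] by one. The only
    node that may be wrong is the parent of the current one. *)
Lemma wp_sift_up st Q : (imem st 7 0 < n.*2)%N ->
  min_tree_except n (imem st 7 0)./2 (rmem st 3) ->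
  (forall t st', (t <= 4 * lg + 1)%N -> frame [:: 7] [:: 3] st st' ->
     min_tree n (rmem st' 3) ->
     (forall j, (n <= j)%N -> rmem st' 3 j = rmem st 3 j) -> Q t st') ->
  wp draws sift_up st Q.
Proof.
move=> i_lt tree HQ.
pose Inv p st' := [/\ frame [:: 7] [:: 3] st st', (imem st' 7 0 < n.*2)%N,
  min_tree_except n (imem st' 7 0)./2 (rmem st' 3),
  (forall j, (n <= j)%N -> rmem st' 3 j = rmem st 3 j) &
  p = (4 * trunc_log 2 (imem st' 7 0))%N].
have I0 : Inv (4 * trunc_log 2 (imem st 7 0))%N st by split.
apply: wp_mono (wp_while (Inv := Inv) _ I0) => [t st' [p [[fr i'n tree' leaves pE] /=]]|].
  rewrite -leqNgt => i1 tp; apply: HQ => //.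
    have : (trunc_log 2 (imem st 7 0) <= lg)%N by apply: leq_trunc_log; exact: ltnW.
    by lia.
  by move: tree'; rewrite (_ : _./2 = 0) //; lia.
move=> {tree i_lt I0 HQ} p st1 [fr i_lt tree leaves pE] /= i1.
set i := imem st1 7 0 in i_lt tree pE i1 *.
have lgi := trunc_log2S i1.
apply: wp_seq; apply: wp_iset => /=; rewrite -/i.
have h0 : (0 < i./2)%N by lia.
have hn : (i./2 < n)%N by lia.
have fixed x : x = Num.min (rmem st1 3 i./2.*2) (rmem st1 3 i./2.*2.+1) ->
  exists p', Inv p' (State (upd (imem st1) 7 0 i./2)
      (upd (rmem st1) 3 i./2 x) (drawn st1)) /\ (p' + 3 < p)%N.
  move=> ->; exists (4 * trunc_log 2 i./2)%N; split; last by lia.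
  split=> //=; first by apply: frame_rset => //; apply: frame_iset => //; exact: frame_eta.
  - by rewrite /upd /=; lia.
  - by have := min_tree_fix h0 tree.
  - move=> j nj; rewrite /upd /= -leaves //.
    by have -> : (j == i./2) = false by lia.
have left : (upd (imem st1) 7 0 i./2 7 0 + upd (imem st1) 7 0 i./2 7 0 = i./2.*2)%N.
  by rewrite addnn.
apply: wp_if => /=; rewrite !left addn1 => lt; apply: wp_rset => /=;
  rewrite !left ?addn1; apply: fixed.
- by rewrite min_l // ltW.
- by rewrite min_r // leNgt.
Qed.

Lemma wp_set_leaf st v x Q : imem st 0 0 = n -> (ieval st v < n)%N ->
  min_tree n (rmem st 3) ->
  (forall t st', (t <= 4 * lg + 3)%N -> frame [:: 7] [:: 3] st st' ->
     min_tree n (rmem st' 3) ->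
     (forall j, rmem st' 3 (n + j) = if j == ieval st v then
         reval (State (upd (imem st) 7 0 (n + ieval st v)) (rmem st) (drawn st)) x
       else rmem st 3 (n + j)) -> Q t st') ->
  wp draws (set_leaf v x) st Q.
Proof.
move=> stn vn tree HQ; apply: wp_seq; apply: wp_iset => /=.
apply: wp_seq; apply: wp_rset => /=; rewrite stn.
set y := reval _ _; apply: wp_sift_up => /=.
- by rewrite /upd /=; lia.
- by rewrite {1}/upd /=; have := min_tree_update y tree (leq_addr (ieval st v) n).
move=> t st' tle fr tree' leaves; apply: HQ => //; first by lia.
  by apply: frame_trans fr; apply: frame_rset => //; exact: frame_iset.
move=> j; rewrite leaves ?leq_addr //= /upd /=.
by rewrite eqn_add2l.
Qed.

Lemma wp_descend st Q : imem st 0 0 = n -> min_tree n (rmem st 3) ->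
  (forall t st' i, (t <= 3 * lg + 2)%N -> frame [:: 7] [::] st st' ->
     imem st' 7 0 = i -> (n <= i < n.*2)%N -> rmem st 3 i = rmem st 3 1 ->
     Q t st') ->
  wp draws descend st Q.
Proof.
move=> stn tree HQ; apply: wp_seq; apply: wp_iset => /=.
set st1 := State _ _ _.
pose Inv p st' := [/\ frame [:: 7] [::] st st', (0 < imem st' 7 0 < n.*2)%N,
  rmem st 3 (imem st' 7 0) = rmem st 3 1 &
  (p + 3 * trunc_log 2 (imem st' 7 0) = 3 * lg)%N].
have fr1 : frame [:: 7] [::] st st1 by apply: frame_iset.
have I1 : Inv (3 * lg)%N st1.
  by split=> //=; rewrite /upd /= ?trunc_log1 //; lia.
apply: wp_mono (wp_while (Inv := Inv) _ I1) => [t st' [p [[fr ilt ri pE] /=]]|].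
  have -> : imem st' 0 0 = n by have [-> //] := fr.
  by rewrite -leqNgt => ni tp; apply: HQ ri => //; lia.
move=> p st2 [fr ilt ri pE] /=; have [_ E3 _] := fr.
have -> : imem st2 0 0 = n by have [-> //] := fr.
move=> i_n; move: ri pE ilt i_n; set i := imem st2 7 0 => ri pE ilt i_n.
have i0 : (0 < i)%N by lia.
have lg2 := trunc_log2_double i0.
have lg21 : trunc_log 2 i.*2.+1 = (trunc_log 2 i).+1.
  by rewrite trunc_log2S /= ?uphalf_double // ltnS double_gt0.
have lgn : ((trunc_log 2 i).+1 <= lg)%N.
  by rewrite -lg2; apply: leq_trunc_log; rewrite leq_double ltnW.
have Ei : min_node (rmem st 3) i by apply: tree; lia.
apply: wp_if => /=; rewrite -/i addnn E3 // => lt; apply: wp_iset => /=;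
  rewrite -/i addnn ?addn1; exists (p - 3)%N; (split; last by lia);
  (split; [by apply: frame_iset => //; exact: frame_eta| | |]); rewrite /upd /= ?lg2 ?lg21 ?E3 //; try lia.
- rewrite -ri Ei minC min_l //; move: lt; rewrite Ei gt_min ltxx /=.
  by move/ltW.
- by rewrite -ri Ei min_l // leNgt; apply: contra lt; rewrite Ei gt_min => ->; rewrite orbT.
Qed.

End TreePrograms.

(** * The shortest-path program *)

(* Cells used: naturals 4 = label (center + 1), 5 = head and 6 = next of the
   linked lists of outgoing edges (edge + 1, 0 = end of list), 7 = tree node,
   8, 13 = loop counters, 9 = settled vertex, 10 = list position, 11 and 12 =
   vertex to relax and its candidate label; reals 2 = tentative value
   min(0, d(c, v) - rho c), 3 = tree, 4 = value of the settled vertex (or the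
   number drawn), 5 = candidate value. *)
Definition relax :=
  If (BRlt (RVar 5) (RGet 2 (Var 11)))
    (Seq (RSet 2 (Var 11) (RVar 5))
      (Seq (ISet 4 (Var 11) (Var 12)) (set_leaf (Var 11) (RVar 5))))
    Skip.

Definition incr a := ISet a (INum 0) (IAdd (Var a) (INum 1)).

Definition draw_centers :=
  While (BIlt (Var 8) (IGet 0 (INum 2)))
    (Seq (ISet 11 (INum 0) (IGet 3 (Var 8)))
    (Seq (Draw 4 (INum 0) (RDiv (RLn (RGet 1 (INum 1))) (RGet 1 (INum 0))))
    (Seq (RSet 5 (INum 0) (RSub (RNum 0) (RVar 4)))
    (Seq (ISet 12 (INum 0) (IAdd (Var 11) (INum 1)))
    (Seq relax (incr 8)))))).

(** For [In] the search runs in the reversed graph. *)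
Definition source_array dir := if dir is Out then 1%N else 2%N.
Definition target_array dir := if dir is Out then 2%N else 1%N.

Definition build_lists dir :=
  let source := IGet (source_array dir) (Var 13) in
  While (BIlt (Var 13) (IGet 0 (INum 1)))
    (Seq (ISet 6 (Var 13) (IGet 5 source))
    (Seq (ISet 5 source (IAdd (Var 13) (INum 1))) (incr 13))).

Definition scan dir :=
  let edge := ISub (Var 10) (INum 1) in
  While (BIlt (INum 0) (Var 10))
    (Seq (ISet 11 (INum 0) (IGet (target_array dir) edge))
    (Seq (RSet 5 (INum 0) (RAdd (RVar 4) (RGet 0 edge)))
    (Seq relax (ISet 10 (INum 0) (IGet 6 edge))))).

(** The leaf value 1 retires the settled vertex: the main loop follows only a negative root. *)
Definition settle dir :=
  Seq descend
    (Seq (ISet 9 (INum 0) (ISub (Var 7) N))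
    (Seq (RSet 4 (INum 0) (RGet 2 (Var 9)))
    (Seq (ISet 12 (INum 0) (IGet 4 (Var 9)))
    (Seq (set_leaf (Var 9) (RNum 1))
    (Seq (ISet 10 (INum 0) (IGet 5 (Var 9))) (scan dir)))))).

Definition cluster_prog dir :=
  Seq draw_centers
    (Seq (build_lists dir)
      (While (BRlt (RGet 3 (INum 1)) (RNum 0)) (settle dir))).

(** * Invariants and cost of the shortest-path program *)

Section Dijkstra.
Variables (R : realType) (draws : nat -> R -> R) (dir : direction).
Variables (n m : nat) (us : seq nat) (beta : R) (st0 : state R).
(** [Dle u v t] abstracts a distance bound [d(u, v) <= t] on vertices stored as naturals. *)
Variable Dle : nat -> nat -> R -> Prop.
Hypothesis n_gt0 : (0 < n)%N.
Implicit Types (st : state R) (D : pred nat).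

Local Notation lg := (trunc_log 2 n.*2).
Local Notation src := (imem st0 (source_array dir)).
Local Notation tgt := (imem st0 (target_array dir)).
Local Notation wgt := (rmem st0 0).
Local Notation rho := (fun u => draws (index u us) beta).

Hypotheses (st0_n : imem st0 0 0 = n) (st0_m : imem st0 0 1 = m).
Hypotheses (st0_q : imem st0 0 2 = size us).
Hypotheses (st0_us : forall i, imem st0 3 i = nth 0%N us i).
Hypothesis st0_beta : ln (rmem st0 1 1) / rmem st0 1 0 = beta.
Hypothesis st0_i0 : forall a i, (4 <= a)%N -> imem st0 a i = 0%N.
Hypothesis st0_r0 : forall a i, (2 <= a)%N -> rmem st0 a i = 0.
Hypothesis st0_d : drawn st0 = 0%N.
Hypothesis us_lt : forall u, u \in us -> (u < n)%N.
Hypothesis us_uniq : uniq us.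
Hypothesis edge_lt : forall k, (k < m)%N -> (src k < n)%N /\ (tgt k < n)%N.
Hypothesis wgt_ge0 : forall k, (k < m)%N -> 0 <= wgt k.
Hypothesis Dle_refl : forall u, u \in us -> Dle u u 0.
Hypothesis Dle_edge : forall u k t, u \in us -> (k < m)%N ->
  Dle u (src k) t -> Dle u (tgt k) (t + wgt k).

Definition keeps st :=
  (forall a, (a < 4)%N -> imem st a = imem st0 a) /\
  (forall a, (a < 2)%N -> rmem st a = rmem st0 a).

Lemma keeps_frame ia ra st st' : all (leq 4) ia -> all (leq 2) ra ->
  keeps st -> frame ia ra st st' -> keeps st'.
Proof.
move=> /allP i4 /allP r2 [ki kr] [fi fr _]; split=> a alt.
  by rewrite fi ?ki //; apply: contraL alt => /i4; rewrite -leqNgt.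
by rewrite fr ?kr //; apply: contraL alt => /r2; rewrite -leqNgt.
Qed.

Definition heap D st := min_tree n (rmem st 3) /\
  forall j, (j < n)%N -> rmem st 3 (n + j)%N = if D j then 1 else rmem st 2 j.

(** The hypothesis on [D] prevents a settled vertex from improving, which would overwrite its leaf
    value 1. *)
Lemma wp_relax st D Q : imem st 0 0 = n -> (imem st 11 0 < n)%N ->
  heap D st -> (D (imem st 11 0) -> rmem st 2 (imem st 11 0) <= rmem st 5 0) ->
  (forall t st', (t <= 4 * lg + 6)%N -> frame [:: 4; 7] [:: 2; 3] st st' ->
    heap D st' ->
    (forall j, rmem st' 2 j =
      if (j == imem st 11 0) && (rmem st 5 0 < rmem st 2 j) then rmem st 5 0
      else rmem st 2 j) ->
    (forall j, imem st' 4 j =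
      if (j == imem st 11 0) && (rmem st 5 0 < rmem st 2 j) then imem st 12 0
      else imem st 4 j) ->
    Q t st') ->
  wp draws relax st Q.
Proof.
move=> stn xn [tree leaves] Dx HQ; set x := imem st 11 0 in xn Dx HQ *.
set c := rmem st 5 0 in Dx HQ *.
apply: wp_if => /=; rewrite -/x -/c => lt; last first.
  apply: wp_skip; apply: HQ => //; first by lia.
    by move=> j; case: eqP => //= ->; rewrite (negbTE lt).
  by move=> j; case: eqP => //= ->; rewrite (negbTE lt).
apply: wp_seq; apply: wp_rset => /=; apply: wp_seq; apply: wp_iset => /=.
rewrite -/x -/c; apply: (wp_set_leaf _ n_gt0) => //= t st' tle fr tree' leaves'.
have [fi f2 _] := fr.
have E2 j : rmem st' 2 j = if (j == x) && (c < rmem st 2 j) then c else rmem st 2 j.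
  by rewrite f2 //= /upd /=; case: eqP => //= ->; rewrite lt.
apply: HQ => //; first by lia.
- apply: (@frame_trans _ _ _ _
    (State (upd (imem st) 4 x (imem st 12 0)) (upd (rmem st) 2 x c) (drawn st))).
    by apply: frame_iset => //; exact: frame_rset.
  by apply: frame_sub fr => a; rewrite !inE => /eqP ->.
- split=> // j jn; rewrite E2; have := leaves' j.
  rewrite /= /upd /= -/x -/c leaves // => ->; case: eqP => [->|//]; rewrite lt /=.
  by case: ifP => // /Dx; rewrite leNgt lt.
- by move=> j; rewrite fi //= /upd /=; case: eqP => //= ->; rewrite lt.
Qed.

(** The label of [v] is a center whose key at [v] is at least minus the tentative value. *)
Definition labels_ok st := forall v, (v < n)%N -> rmem st 2 v <= 0 /\
  if imem st 4 v is c.+1 then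
    [/\ c \in us, rmem st 2 v < 0 & Dle c v (rmem st 2 v + rho c)]
  else rmem st 2 v = 0.

Lemma wp_relax_ok st D c Q : keeps st -> (imem st 11 0 < n)%N ->
  heap D st -> labels_ok st ->
  (D (imem st 11 0) -> rmem st 2 (imem st 11 0) <= rmem st 5 0) ->
  imem st 12 0 = c.+1 -> c \in us -> Dle c (imem st 11 0) (rmem st 5 0 + rho c) ->
  (forall t st', (t <= 4 * lg + 6)%N -> frame [:: 4; 7] [:: 2; 3] st st' ->
    keeps st' -> heap D st' -> labels_ok st' ->
    rmem st' 2 (imem st 11 0) <= rmem st 5 0 ->
    (forall j, rmem st' 2 j <= rmem st 2 j) ->
    (forall j, D j -> rmem st' 2 j = rmem st 2 j) ->
    (forall j x, x <= rmem st 2 j -> x <= rmem st 5 0 -> x <= rmem st' 2 j) ->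
    Q t st') ->
  wp draws relax st Q.
Proof.
move=> kst xn hp lab Dx Ec cus Dcx HQ; have [ki _] := kst.
apply: (wp_relax _ _ hp Dx) => // [|t st' tle fr hp' E2 E4]; first by rewrite ki.
apply: HQ => //.
- exact: keeps_frame fr.
- move=> v vn; rewrite E2 E4; have [L0 lv] := lab v vn.
  case: ifP => // /andP[/eqP vx lt]; rewrite Ec.
  have c0 := lt_le_trans lt L0.
  by split; [exact: ltW|split; rewrite // vx].
- by rewrite E2 eqxx /=; case: ltP.
- by move=> j; rewrite E2; case: ifP => // /andP[_ /ltW].
- move=> j Dj; rewrite E2; case: eqP => //= E; rewrite E in Dj *.
  by rewrite ltNge Dx.
- by move=> j x xL xc; rewrite E2; case: ifP.
Qed.

Definition sources_ok k st :=
  forall i, (i < k)%N -> rmem st 2 (nth 0%N us i) <= - rho (nth 0%N us i).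

Definition untouched st := [/\ imem st 5 = imem st0 5, imem st 6 = imem st0 6 &
  imem st 13 = imem st0 13].

Lemma wp_draw_centers Q :
  (forall t st, (t <= size us * (4 * lg + 12) + 1)%N -> keeps st ->
    untouched st -> heap pred0 st -> labels_ok st -> sources_ok (size us) st ->
    Q t st) ->
  wp draws draw_centers st0 Q.
Proof.
move=> HQ.
pose Inv p st := [/\ keeps st, untouched st, heap pred0 st, labels_ok st &
  [/\ (imem st 8 0 <= size us)%N, drawn st = imem st 8 0,
     sources_ok (imem st 8 0) st & p = ((size us - imem st 8 0) * (4 * lg + 12))%N]].
have I0 : Inv (size us * (4 * lg + 12))%N st0.
  split=> //; last by rewrite st0_i0 // st0_d subn0; split.
    (* The zero-initialized array is already a tree of minima for the zero values. *)
    split=> [j _ _|j _]; rewrite /min_node ?st0_r0 //.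
    by rewrite minxx.
  by move=> v _; rewrite st0_i0 // st0_r0.
apply: wp_mono (wp_while (Inv := Inv) _ I0) => [t st [p [[kst un hp lab]]]|].
  move=> [kq dk so pE] /=; have [ki _] := kst; rewrite (ki 0%N) // st0_q -leqNgt => qk tp.
  apply: HQ => //; first by lia.
  by rewrite (_ : size us = imem st 8 0) //; apply/eqP; rewrite eqn_leq qk.
move=> {I0 HQ} p st [kst [un5 un6 un13] hp lab [kq dk so pE]] /=.
have [ki kr] := kst; rewrite (ki 0%N) // st0_q => kus.
set k := imem st 8 0 in kq dk so pE kus *.
apply: wp_seq; apply: wp_iset => /=; apply: wp_seq; apply: wp_draw => /=.
apply: wp_seq; apply: wp_rset => /=; apply: wp_seq; apply: wp_iset => /=.
set u := nth 0%N us k.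
have uus : u \in us by rewrite mem_nth.
(* The draw counter equals the loop counter, so the [k]-th center receives draw [k]. *)
have iu : index u us = k by rewrite index_uniq.
have -> : draws (drawn st) (ln (rmem st 1 1) / rmem st 1 0) = rho u.
  by rewrite dk (kr 1%N) // st0_beta iu.
have -> : imem st 3 (imem st 8 0) = u by rewrite (ki 3) // st0_us.
rewrite sub0r addn1.
set st1 := State _ _ _.
have kst1 : keeps st1.
  by split=> a alt; rewrite /st1 /= !upd_other ?ki ?kr //; lia.
apply: wp_seq; apply: (wp_relax_ok (D := pred0) (c := u)) => //.
- exact: us_lt.
- by rewrite /= /upd /= addNr; exact: Dle_refl.
move=> t st' tle fr kst' hp' lab' Lu Lle _ _.
have [fi f2 fd] := fr; apply: wp_iset => /=.
rewrite (fi 8) // -[imem st1 8 0]/k addn1.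
exists ((size us - k.+1) * (4 * lg + 12))%N; split; last first.
  have -> : p = ((size us - k.+1).+1 * (4 * lg + 12))%N by rewrite pE; congr (_ * _)%N; lia.
  by rewrite mulSn; lia.
split=> //.
- apply: (keeps_frame (ia := [:: 8]) (ra := [::]) isT isT kst').
  by apply: frame_iset => //; apply: frame_eta; exact: frame_refl.
- by split; rewrite /= upd_other // fi // /st1 /= !upd_other.
- split=> //=; first by rewrite fd /= dk.
  rewrite /upd /= => i; rewrite ltnS leq_eqVlt => /orP[/eqP ->|ik].
    by apply: le_trans Lu _.
  by apply: le_trans (Lle _) _; exact: so.
Qed.

(** Latest edge first, the order produced by prepending to the linked list. *)
Fixpoint out v k :=
  if k is k'.+1 then if src k' == v then k' :: out v k' else out v k' else [::].

Lemma mem_out v k i : (i \in out v k) = (i < k)%N && (src i == v).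
Proof.
elim: k => //= k IHk; rewrite ltnS; case: ifP => Ek; rewrite ?inE IHk (leq_eqVlt i k).
  by case: (i =P k) => [->|] //=; rewrite Ek.
by case: (i =P k) => [->|] //=; rewrite Ek ltnn.
Qed.

(** Each edge is counted once, at its source; this bounds the cost of all scans together. *)
Lemma sum_out k : (k <= m)%N -> (\sum_(v < n) size (out v k) = k)%N.
Proof.
elim: k => [|k IHk] km; first by rewrite big1.
have [sn _] := edge_lt km.
rewrite (eq_bigr (fun v : 'I_n => (src k == v) + size (out v k))%N); last first.
  by move=> v _ /=; case: ifP.
rewrite big_split /= (IHk (ltnW km)) (bigD1 (Ordinal sn)) //= eqxx big1 //.
by move=> v /eqP vs; case: eqP => // E; case: vs; apply: val_inj.
Qed.

Fixpoint chain (next : nat -> nat) h l :=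
  if l is e :: l' then h = e.+1 /\ chain next (next e) l' else h = 0%N.

Lemma chain_upd next k x h l : all (fun e => e < k)%N l ->
  chain next h l -> chain (fun j => if j == k then x else next j) h l.
Proof.
elim: l h => //= e l IHl h /andP[ek lk] [-> ch]; split=> //.
by rewrite ltn_eqF //; exact: IHl.
Qed.

Definition lists_ok k st := forall v, chain (imem st 6) (imem st 5 v) (out v k).

Lemma wp_build_lists st1 Q : keeps st1 -> untouched st1 ->
  (forall t st, (t <= 4 * m + 1)%N -> frame [:: 5; 6; 13] [::] st1 st ->
    lists_ok m st -> Q t st) ->
  wp draws (build_lists dir) st1 Q.
Proof.
move=> kst1 [un5 un6 un13] HQ.
pose Inv p st := [/\ frame [:: 5; 6; 13] [::] st1 st, (imem st 13 0 <= m)%N,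
  lists_ok (imem st 13 0) st & p = (4 * (m - imem st 13 0))%N].
have I0 : Inv (4 * m)%N st1.
  split=> //; rewrite un13 st0_i0 // ?subn0 // => v.
  by rewrite /= un5 st0_i0.
apply: wp_mono (wp_while (Inv := Inv) _ I0) => [t st [p [[fr km li pE]]]|].
  have [ki _] := keeps_frame (ia := [:: 5; 6; 13]) (ra := [::]) isT isT kst1 fr.
  rewrite /= (ki 0%N) // st0_m -leqNgt => mk tp; apply: HQ => //; first by lia.
  by rewrite (_ : m = imem st 13 0) //; apply/eqP; rewrite eqn_leq mk.
move=> {I0 HQ} p st [fr km li pE].
have [ki _] := keeps_frame (ia := [:: 5; 6; 13]) (ra := [::]) isT isT kst1 fr.
rewrite /= (ki 0%N) // st0_m => km'; set k := imem st 13 0 in km li pE km' *.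
have ksrc : imem st (source_array dir) k = src k by rewrite ki //; case: (dir).
apply: wp_seq; apply: wp_iset => /=; apply: wp_seq; apply: wp_iset => /=.
apply: wp_iset => /=; rewrite -/k.
have E13 : upd (imem st) 6 k (imem st 5 (imem st (source_array dir) k)) 13 0 = k by [].
have Es : upd (imem st) 6 k (imem st 5 (imem st (source_array dir) k))
    (source_array dir) k = src k by rewrite upd_other //; case: (dir).
rewrite E13 Es ksrc.
have -> : upd (upd (imem st) 6 k (imem st 5 (src k))) 5 (src k) (k + 1) 13 0 = k by [].
rewrite addn1; exists (4 * (m - k.+1))%N; split; last by lia.
split=> //.
  by do 3![apply: frame_iset => //]; exact: frame_eta.
have allk v : all (fun e => e < k)%N (out v k).
  by apply/allP => e; rewrite mem_out => /andP[].
rewrite /lists_ok /= /upd /= => v; rewrite (eq_sym v) /=.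
case: eqP => [<-|vs]; last exact: chain_upd.
by split=> //; rewrite eqxx; exact: chain_upd.
Qed.

Definition all_sources_ok st := sources_ok (size us) st.

(* Invariant of the scan of the edges leaving the settled vertex v, whose value
   d is the largest settled one and whose center is c. *)
Definition scanning D v d c l st :=
  [/\ keeps st, lists_ok m st, heap D st, labels_ok st & all_sources_ok st] /\
  [/\ rmem st 4 0 = d, imem st 12 0 = c.+1, chain (imem st 6) (imem st 10 0) l,
      {subset l <= out v m} &
      forall k, k \in out v m -> k \notin l -> rmem st 2 (tgt k) <= d + wgt k] /\
  [/\ rmem st 2 v = d,
      forall k, (k < m)%N -> D (src k) -> src k != v ->
        rmem st 2 (tgt k) <= rmem st 2 (src k) + wgt k,
      forall y, (y < n)%N -> D y -> rmem st 2 y <= d &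
      forall y, (y < n)%N -> ~~ D y -> d <= rmem st 2 y].

(** Weights are nonnegative, so every candidate is at least [d]: settled vertices cannot improve,
    and unsettled ones stay at or above [d]. *)
Lemma wp_scan D v d c l st Q : D v -> c \in us -> Dle c v (d + rho c) ->
  scanning D v d c l st ->
  (forall t st', (t <= size l * (4 * lg + 10) + 1)%N ->
    scanning D v d c [::] st' -> Q t st') ->
  wp draws (scan dir) st Q.
Proof.
move=> Dv cus Dcv I0 HQ.
pose Inv p st' := exists2 l, scanning D v d c l st' & p = (size l * (4 * lg + 10))%N.
have {}I0 : Inv (size l * (4 * lg + 10))%N st by exists l.
apply: wp_mono (wp_while (Inv := Inv) _ I0) => [t st' [p [[l' Il' pE] /=]]|].
  rewrite -leqNgt => e0 tp; apply: HQ; first by lia.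
  case: Il' => inv [[d4 l12 ch sub scanned] rest]; split=> //; split=> //.
  by case: l' ch e0 pE sub scanned => //= e l' [-> _].
move=> {l st I0 HQ} p st [l [inv [[d4 l12 ch sub scanned] rest]] ->] /= e0.
case: l ch sub scanned => [/= E|e l /= [Ee ch] sub scanned]; first by rewrite E in e0.
have eout : e \in out v m by apply: sub; rewrite mem_head.
have subl : {subset l <= out v m} by move=> k kl; apply: sub; rewrite inE kl orbT.
have := eout; rewrite mem_out => /andP[em /eqP es].
have [kst li hp lab so] := inv; have [Lv settled Dle_d d_le] := rest.
have [ki kr] := kst; have [_ tn] := edge_lt em; have w0 := wgt_ge0 em.
apply: wp_seq; apply: wp_iset => /=; apply: wp_seq; apply: wp_rset => /=.
have -> : (upd (imem st) 11 0 (imem st (target_array dir) (imem st 10 0 - 1)) 10 0 - 1 = e)%N.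
  by rewrite /upd /= Ee subn1.
rewrite d4 (kr 0%N) // (ki (target_array dir)); last by case: (dir).
set st1 := State _ _ _.
have kst1 : keeps st1.
  by split=> a alt; rewrite /st1 /= !upd_other ?ki ?kr //; lia.
apply: wp_seq; apply: (wp_relax_ok (D := D) (c := c)) => //.
- rewrite /= /upd /= => Dx; apply: le_trans (Dle_d _ tn Dx) _.
  by rewrite lerDl.
- rewrite /= /upd /= addrAC -es in Dcv *.
  by apply: Dle_edge.
rewrite -[imem st1 11 0]/(tgt e) -[rmem st1 5 0]/(d + wgt e) -[rmem st1 2]/(rmem st 2).
move=> t st' tle fr kst' hp' lab' Lx Lle LD Lge; have [fi f2 _] := fr.
apply: wp_iset => /=.
have E10 : imem st' 10 0 = e.+1 by rewrite fi // -Ee.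
have E6 : imem st' 6 = imem st 6 by rewrite fi.
rewrite E10 E6 subn1 /=.
exists (size l * (4 * lg + 10))%N; split; last by rewrite mulSn; lia.
exists l => //; split; last split; split=> //=.
- apply: (keeps_frame (ia := [:: 10]) (ra := [::]) isT isT kst').
  by apply: frame_iset => //; apply: frame_eta; exact: frame_refl.
- move=> y /=; have -> : upd (imem st') 10 0 (imem st 6 e) 6 = imem st' 6.
    exact: upd_other.
  have -> : upd (imem st') 10 0 (imem st 6 e) 5 = imem st' 5 by exact: upd_other.
  by rewrite E6 fi // ; exact: li.
- by move=> i ilt; apply: le_trans (Lle _) (so i ilt).
- by rewrite f2.
- by rewrite /upd /= fi.
- by rewrite upd_other // E6 /upd /=.
- move=> k kout kl; have [->|ke] := eqVneq k e; first exact: Lx.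
  by apply: le_trans (Lle _) _; apply: scanned; rewrite // inE negb_or ke.
- by rewrite LD.
- move=> k km Dk kv; rewrite (LD (src k)) //.
  by apply: le_trans (Lle _) _; exact: settled.
- by move=> y yn Dy; rewrite LD //; exact: Dle_d.
- move=> y yn nDy; apply: Lge; first exact: d_le.
  by rewrite lerDl.
Qed.

(** [D] is a ghost set of settled vertices: the edges leaving them are relaxed, and their values do
    not exceed the unsettled ones. *)
Definition settled_ok D st :=
  [/\ keeps st, lists_ok m st, heap D st, labels_ok st & all_sources_ok st] /\
  (forall k, (k < m)%N -> D (src k) ->
    rmem st 2 (tgt k) <= rmem st 2 (src k) + wgt k) /\
  (forall v y, (v < n)%N -> (y < n)%N -> D v -> ~~ D y ->
    rmem st 2 v <= rmem st 2 y).

(** Each unsettled vertex still pays for a descent ([3 * lg + 2]), a leaf update ([4 * lg + 3]), 6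
    further units, and the scan of its edges. *)
Definition remaining D :=
  (\sum_(v < n | ~~ D v) ((7 * lg + 11) + size (out v m) * (4 * lg + 10)))%N.

Lemma root_le D st j : heap D st -> (j < n)%N -> ~~ D j ->
  rmem st 3 1 <= rmem st 2 j.
Proof.
move=> [tree leaves] jn nDj; have := leaves j jn; rewrite (negbTE nDj) => <-.
by apply: (min_tree_root_le tree); lia.
Qed.

Lemma wp_settle D st : settled_ok D st -> rmem st 3 1 < 0 ->
  wp draws (settle dir) st (fun t st' => exists D',
    settled_ok D' st' /\ (remaining D' + t < remaining D)%N).
Proof.
move=> [[kst li hp lab so] [settled order]] root_lt0; have [tree leaves] := hp.
have [ki kr] := kst; have kn : imem st 0 0 = n by rewrite ki.
apply: wp_seq; apply: (wp_descend _ n_gt0) => // t1 st1 i t1le fr1 Ei iran root.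
have [fi1 f1 _] := fr1.
pose v := (i - n)%N.
have vn : (v < n)%N by rewrite /v; lia.
have iv : i = (n + v)%N by rewrite /v; lia.
have Kv := leaves v vn; rewrite -iv root in Kv.
(* A settled leaf holds 1, which cannot be the negative root. *)
have nDv : ~~ D v by apply/negP => Dv; move: root_lt0; rewrite Kv Dv ltNge ler01.
rewrite (negbTE nDv) in Kv.
have [L0] := lab v vn.
(* An unlabeled vertex has value 0, again not the negative root. *)
case Ec : (imem st 4 v) => [|c]; first by move=> Lv0; rewrite Kv Lv0 ltxx in root_lt0.
case=> cus _ Dcv; set d := rmem st 2 v in Kv L0 Dcv *.
apply: wp_seq; apply: wp_iset => /=; rewrite Ei fi1 // kn -/v.
apply: wp_seq; apply: wp_rset => /=; rewrite f1 //.
have -> : upd (imem st1) 9 0 v 9 0 = v by [].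
apply: wp_seq; apply: wp_iset => /=.
have -> : upd (imem st1) 9 0 v 9 0 = v by [].
have -> : upd (imem st1) 9 0 v 4 v = c.+1 by rewrite upd_other // fi1.
set st2 := State _ _ _.
have fr2 : frame [:: 7; 9; 12] [:: 4] st st2.
  apply: (frame_trans (st2 := st1)); first by apply: frame_sub fr1 => a; rewrite !inE => // ->.
  apply: frame_iset => //; apply: frame_rset => //; exact: frame_iset.
have [fi2 f2 _] := fr2.
apply: wp_seq; apply: (wp_set_leaf _ n_gt0).
- by rewrite fi2.
- exact: vn.
- by rewrite f2.
move=> t3 st3 t3le fr3 tree3 leaves3.
have v2 : ieval st2 (Var 9) = v by [].
have fr23 : frame [:: 7; 9; 12] [:: 3; 4] st st3.
  apply: frame_trans (frame_sub _ _ fr2) (frame_sub _ _ fr3) => a;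
    rewrite !inE => //; by [move=> ->; rewrite ?orbT | move/eqP->].
have [fi3 f3 _] := fr23; have [fi23 f23 _] := fr3.
apply: wp_seq; apply: wp_iset => /=.
have -> : imem st3 9 0 = v by rewrite fi23.
rewrite fi3 //; set st4 := State _ _ _.
pose D' u := (u == v) || D u.
have E2 : rmem st4 2 = rmem st 2 by rewrite /= f3.
have E4 : imem st4 4 = imem st 4 by rewrite /= upd_other // fi3.
have inv4 : scanning D' v d c (out v m) st4.
  split; last split; split=> //.
  - apply: keeps_frame (kst) (_ : frame [:: 7; 9; 12; 10] [:: 3; 4] st st4) => //.
    apply: frame_iset => //; apply: frame_eta.
    by apply: frame_sub fr23 => // a; rewrite !inE => /or3P[]->; rewrite ?orbT.
  - move=> y; rewrite /= !upd_other // !fi3 //; exact: li.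
  - split=> // j jn; rewrite E2 /= leaves3 v2 f2 // leaves // /D'.
    by case: eqP.
  - by move=> y yn; rewrite E2 E4; exact: lab.
  - by move=> k kq; rewrite E2; exact: so.
  - by rewrite /= f23.
  - by rewrite /= upd_other // fi23.
  - by rewrite /= upd_other // fi3 // /upd /=; exact: li.
  - by move=> k kout /negP.
  - by rewrite E2.
  - move=> k km; rewrite /D' => /orP[->//|Dk] _; rewrite E2.
    exact: settled.
  - move=> y yn; rewrite /D' E2 => /orP[/eqP -> //|Dy].
    exact: order.
  - move=> y yn; rewrite /D' negb_or E2 => /andP[_ nDy].
    by rewrite -Kv; exact: root_le hp _ _.
apply: (wp_scan _ cus Dcv inv4); first by rewrite /D' eqxx.
move=> t5 st5 t5le [inv5 [[_ _ _ _ scanned] [Lv settled5 le_d d_le]]].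
exists D'; split.
  split=> //; split=> [k km|u y un yn Du nDy]; last exact: le_trans (le_d _ _ _) (d_le _ _ _).
  have [kv _|kv Dk] := eqVneq (src k) v; last exact: settled5.
  by rewrite kv Lv; apply: scanned; rewrite // mem_out km kv eqxx.
rewrite {2}/remaining (bigD1 (Ordinal vn)) //=.
have -> : (\sum_(u < n | ~~ D u && (u != Ordinal vn))
    (7 * lg + 11 + size (out u m) * (4 * lg + 10)) = remaining D')%N.
  by apply: eq_bigl => u; rewrite /D' negb_or andbC.
lia.
Qed.

(** The source and edge inequalities bound all keys by minus the value; the labels show that the
    bound is attained. *)
Definition solved st :=
  [/\ labels_ok st, all_sources_ok st &
    forall k, (k < m)%N -> rmem st 2 (tgt k) <= rmem st 2 (src k) + wgt k].

Lemma wp_cluster_prog : (size us <= n)%N ->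
  wp draws (cluster_prog dir) st0 (fun t st =>
    (t <= 26 * (n + m) * lg.+1)%N /\ solved st).
Proof.
move=> usn; apply: wp_seq; apply: wp_draw_centers => t1 st1 t1le kst1 un1 hp1 lab1 so1.
apply: wp_seq; apply: wp_build_lists => // t2 st2 t2le fr2 li2.
have [fi2 f2 _] := fr2.
pose Inv p st := exists2 D, settled_ok D st & p = remaining D.
have I2 : Inv (remaining pred0) st2.
  exists pred0 => //; split; last by [].
  split=> //; first exact: (keeps_frame (ia := [:: 5; 6; 13]) (ra := [::]) isT isT kst1 fr2).
  - by rewrite /heap !f2.
  - by move=> v vn; rewrite f2 // fi2 //; exact: lab1.
  - by move=> k kq; rewrite f2 //; exact: so1.
apply: wp_mono (wp_while (Inv := Inv) _ I2) => [t3 st3 [p [[D ok3 pE] /=]]|].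
  rewrite -leNgt => root0 t3le; case: ok3 => [[kst3 li3 hp3 lab3 so3] [settled order]].
  split.
    (* The total is at most [n * (11 * lg + 23) + m * (4 * lg + 14) + 3]; as [n] is positive, the
       last 3 raises 23 to 26. *)
    have : (remaining pred0 = n * (7 * lg + 11) + m * (4 * lg + 10))%N.
      rewrite /remaining big_split /= sum_nat_const card_ord.
      by rewrite -big_distrl /= (sum_out (leqnn m)).
    have : (size us * (4 * lg + 12) <= n * (4 * lg + 12))%N by rewrite leq_mul2r usn orbT.
    nia.
  split=> // k km; have [sn tn] := edge_lt km; have w0 := wgt_ge0 km.
  (* At exit the root is nonnegative, so an unsettled source has value at least 0, while every
     target has value at most 0: an unscanned edge satisfies its inequality anyway. *)
  have [/settled -> //|nD] := boolP (D (src k)).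
  have Ls := le_trans root0 (root_le hp3 sn nD).
  have [Lt _] := lab3 _ tn.
  by apply: le_trans Lt (addr_ge0 Ls w0).
move=> p st [D okD ->] /= root; apply: wp_mono (wp_settle okD root) => t st' [D' [ok' lt]].
by exists (remaining D'); split=> //; exists D'.
Qed.

End Dijkstra.

(** * From the final memory to a clustering *)

Section Correctness.
Variables (R : realType) (dir : direction) (n : nat) (G : wdigraph R n).
Variables (U : {set 'I_n}) (es : seq ('I_n * 'I_n)) (us : seq 'I_n) (r : R).
Variables (s : nat) (draws : nat -> R -> R).
Hypotheses (n_gt0 : (0 < n)%N) (es_edges : es =i edges G).
Hypotheses (us_uniq : uniq us) (us_U : us =i U).

Local Notation st0 := (input_state G es us r s).
Local Notation beta := (cluster_rate s r).

Definition reaches_within (u v : nat) (t : R) := exists x y : 'I_n,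
  [/\ val x = u, val y = v & (center_dist dir G x y <= t%:E)%E].

Definition source (e : 'I_n * 'I_n) := if dir is Out then e.1 else e.2.
Definition target (e : 'I_n * 'I_n) := if dir is Out then e.2 else e.1.

Lemma imem_source k e0 : (k < size es)%N ->
  imem st0 (source_array dir) k = source (nth e0 es k).
Proof. by move=> km; rewrite /source; case: dir; rewrite /= (nth_map e0). Qed.

Lemma imem_target k e0 : (k < size es)%N ->
  imem st0 (target_array dir) k = target (nth e0 es k).
Proof. by move=> km; rewrite /target; case: dir; rewrite /= (nth_map e0). Qed.

Lemma rmem_weight k e0 : (k < size es)%N ->
  rmem st0 0 k = weight G (nth e0 es k).1 (nth e0 es k).2.
Proof. by move=> km; rewrite /= (nth_map e0). Qed.

Lemma reaches_within_edge c e t : e \in edges G ->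
  (center_dist dir G c (source e) <= t%:E)%E ->
  (center_dist dir G c (target e) <= (t + weight G e.1 e.2)%:E)%E.
Proof.
case: e => x y xy; rewrite /source /target EFinD; have := dist_edge xy.
case: dir => /= xyw ct.
  by apply: le_trans (dist_triangle G c x y) _; exact: leeD.
by apply: le_trans (dist_triangle G x y c) _; rewrite addeC; exact: leeD.
Qed.

Lemma cluster_prog_solves :
  wp draws (cluster_prog dir) st0 (fun t st =>
    (t <= 26 * (n + size es) * (trunc_log 2 n.*2).+1)%N /\
    solved draws dir n (size es) (map val us) beta st0 reaches_within st).
Proof.
(* The edge found serves as its own default for [nth]. *)
have edge0 k : (k < size es)%N -> exists2 e, nth e es k = e & e \in edges G.
  case: es es_edges => // e0 es' H km; exists (nth e0 (e0 :: es') k).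
    exact: set_nth_default.
  by rewrite -H mem_nth.
apply: wp_cluster_prog => //.
- by rewrite size_map.
- by case=> [|[|[|[|a]]]] //= i _; rewrite !nth_nil.
- by case=> [|[|a]] //= i _; rewrite !nth_nil.
- by move=> u /mapP[x _ ->]; exact: ltn_ord.
- by rewrite map_inj_uniq //; exact: val_inj.
- by move=> k km; have [e _ _] := edge0 k km;
    rewrite (imem_source e km) (imem_target e km); split; exact: ltn_ord.
- move=> k km; have [e ek eG] := edge0 k km; rewrite (rmem_weight e km) ek.
  by apply: weight_ge0; rewrite -surjective_pairing.
- by move=> u /mapP[x _ ->]; exists x, x; rewrite center_dist_refl.
- move=> u k t _ km [x [y [xu yk xy]]]; have [e ek eG] := edge0 k km.
  exists x, (target e); rewrite (imem_target e km) (rmem_weight e km) ek; split=> //.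
  apply: reaches_within_edge => //; rewrite (imem_source e km) ek in yk.
  by rewrite -(val_inj yk).
- by rewrite size_map -[leqRHS]card_ord -(card_uniqP us_uniq) max_card.
Qed.

(** The values are a potential, so no key at [v] exceeds [- L v]; the labeled center reaches this
    bound and hence maximizes the key. *)
Lemma solved_outcome st :
  solved draws dir n (size es) (map val us) beta st0 reaches_within st ->
  exists2 A : clustering n, output_clustering st A &
    cluster_outcome dir G U (fun u => draws (index u us) beta) A.
Proof.
move=> [lab src_ok edge_ok]; set rho := fun u : 'I_n => _.
have rhoE (u : 'I_n) : draws (index (val u) (map val us)) beta = rho u.
  by rewrite index_map //; exact: val_inj.
pose L (v : 'I_n) := rmem st 2 v.
have L_edge e : e \in edges G -> L (target e) <= L (source e) + weight G e.1 e.2.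
  rewrite -es_edges => ees; have km : (index e es < size es)%N by rewrite index_mem.
  have := edge_ok _ km; rewrite (imem_target e km) (imem_source e km).
  by rewrite (rmem_weight e km) nth_index.
have L_dist c v : ((L v - L c)%:E <= center_dist dir G c v)%E.
  rewrite /source /target in L_edge; case: dir L_edge => L_edge /=.
    by apply: potential_le_dist => x y /L_edge.
  by apply: potential_le_dist_rev => x y /L_edge.
have key_le c v : c \in U -> ((rho c)%:E - center_dist dir G c v <= (- L v)%:E)%E.
  rewrite -us_U => cus; have := src_ok (index c us).
  rewrite size_map index_mem => /(_ cus); rewrite (nth_map c) ?index_mem //.
  rewrite nth_index // rhoE -/(L c) => Lc.
  apply: le_trans (leeB (lexx _) (L_dist c v)) _; rewrite -EFinB lee_fin.
  by move: Lc; lra.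
exists (fun v : 'I_n => if imem st 4 v is c.+1 then insub c else None) => [|key] v;
  have [L0 lv] := lab v (ltn_ord v).
  case: (imem st 4 v) lv => [//|c] [/mapP[x _ ->] _ _].
  by rewrite valK.
case: (imem st 4 v) lv => [Lv0|c [/mapP[x xus ->] Lv [y [z [yx zv yz]]]]].
  by move=> c cU; apply: le_trans (key_le c v cU) _; rewrite /L Lv0 oppr0.
rewrite valK; have xU : x \in U by rewrite -us_U.
have keyx : ((- L v)%:E <= (rho x)%:E - center_dist dir G x v)%E.
  rewrite -(val_inj yx) -(val_inj zv); rewrite -[val x]yx rhoE in yz.
  have D0 := center_dist_ge0 G dir y z.
  have fD : center_dist dir G y z \is a fin_num.
    by rewrite ge0_fin_numE // (le_lt_trans yz) // ltry.
  move: yz; rewrite -(fineK fD) -EFinB !lee_fin => yz; move: yz.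
  by rewrite -zv -/(L z); lra.
split=> //.
  by apply: lt_le_trans keyx; rewrite lte_fin oppr_gt0.
by move=> c1 c1U; apply: le_trans keyx; exact: key_le.
Qed.

End Correctness.

(** Logarithms of [2 ^ trunc_log 2 k <= k]. *)
Lemma natr_trunc_log2_le (R : realType) k : (0 < k)%N ->
  (trunc_log 2 k)%:R * ln 2%:R <= ln k%:R :> R.
Proof.
move=> k0; rewrite mulr_natl -lnXn ?ltr0n // -natrX ler_ln ?posrE ?ltr0n ?expn_gt0 //.
by rewrite ler_nat trunc_logP.
Qed.

Theorem theorem4 (R : realType) (dir : direction) :
  (forall (n : nat) (G : wdigraph R n) (U S : {set 'I_n}) (r : R)
      (d : measure_display) (T : measurableType d) (P : probability T R)
      (X : 'I_n -> {RV P >-> R}) (A : T -> clustering n),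
    (2 <= #|S|)%N -> 0 < r ->
    iid_exponential U (cluster_rate #|S| r) X ->
    (forall w : T, cluster_outcome dir G U (fun u => X u w) (A w)) ->
    [/\ (forall c : R, 1 <= c ->
          prob_at_least P
            [set w | forall x : 'I_n, x \in U ->
                       (cluster_radius dir G (A w) x <= (c * r)%:E)%E]
            (1 - n%:R / #|S|%:R `^ c)),
        {ae P, forall w : T, (#|last_cluster (A w)| <= n - #|U|)%N} &
        (forall (u v : 'I_n) (rad : R), u \in S -> 0 < rad ->
          (roundtrip G u v <= rad%:E)%E ->
          prob_at_least P [set w | same_cluster (A w) u v]
            (expR (- (rad / r * ln #|S|%:R))))])
  /\
  (exists (prog : cmd) (C : R),
    forall (n : nat) (G : wdigraph R n) (U S : {set 'I_n}) (r : R)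
      (es : seq ('I_n * 'I_n)) (us : seq 'I_n) (draws : nat -> R -> R),
    (2 <= #|S|)%N -> 0 < r ->
    uniq es -> es =i edges G ->
    uniq us -> us =i U ->
    let m := #|edges G| in
    exists (t : nat) (st : state R) (A : clustering n),
      [/\ exec draws prog (input_state G es us r #|S|) t st,
          output_clustering st A,
          cluster_outcome dir G U
            (fun u => draws (index u us) (cluster_rate #|S| r)) A,
          t%:R <= C * (n + m)%:R * ln n%:R :> R &
          ((n <= m.+1)%N -> t%:R <= C * m%:R * ln n%:R :> R)]).

Proof.
split=> [n G U S r d T P X A S2 r0 iidX outA|].
  split=> [c c1||u v rad _ rad0 uv].
  - exact: (radius_guarantee S2 r0 iidX outA).
  - exact: (last_cluster_guarantee iidX outA).
  - exact: (same_cluster_guarantee S2 r0 iidX outA).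
(* [234 = 26 * 3 * 3]: one factor 3 from [l + 2 <= 3 * l] with [l = trunc_log 2 n], the other from
   [n + m <= 3 * m] in the second bound; [ln 2] changes the base of the logarithm. *)
exists (cluster_prog dir), (234 / ln 2%:R) => n G U S r es us draws S2 r0 es_uniq esE us_uniq usU m.
(* Two elements of [S] force [n >= 2], so [trunc_log 2 n] is positive and can absorb additive
   constants. *)
have n2 : (2 <= n)%N by apply: leq_trans S2 _; rewrite -[leqRHS]card_ord max_card.
have n0 := ltnW n2.
have sm : size es = m by rewrite /m -(eq_card esE) (card_uniqP es_uniq).
have [t [st [ex [tle /(solved_outcome esE usU)[A outA cA]]]]] :=
  cluster_prog_solves dir r #|S| draws n0 esE us_uniq.
have ln2 : 0 < ln 2%:R :> R by rewrite ln_gt0 // ltr1n.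
have log_le := natr_trunc_log2_le R n0.
have tle78 : (t <= 78 * (n + m) * trunc_log 2 n)%N.
  move: tle; rewrite sm trunc_log2_double //.
  have : (0 < trunc_log 2 n)%N by rewrite trunc_log_gt0.
  move: (trunc_log 2 n) (n + m)%N => l p l0 tle; nia.
have bound q C : (78 * (n + m) <= C * q)%N ->
    t%:R <= C%:R / ln 2%:R * q%:R * ln n%:R :> R.
  move=> qle.
  have : t%:R <= C%:R * q%:R * (trunc_log 2 n)%:R :> R.
    rewrite -!natrM ler_nat; apply: leq_trans tle78 _.
    by rewrite leq_mul2r qle orbT.
  move/le_trans; apply.
  have -> : C%:R / ln 2%:R * q%:R * ln n%:R = C%:R * q%:R * (ln n%:R / ln 2%:R) :> R.
    by ring.
  by rewrite ler_wpM2l ?mulr_ge0 // ler_pdivlMr.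
exists t, st, A; split=> //.
- by apply: (bound _ 234); lia.
(* Here [n >= 2] and [n <= m.+1] give [m >= 1], hence [n + m <= 3 * m]. *)
- by move=> nm; apply: (bound _ 234); lia.
Qed.
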